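(* If $p=2$, the Gross lattice of the unique (up to $\overline{\mathbb{F}}_2$-isomorphism) supersingular elliptic curve over $\overline{\mathbb{F}}_2$ is well-rounded but not orthogonal, and the Gram matrix of a normalized successive minimal basis of it is $$\begin{pmatrix} 3 & 1 & 1\\ 1 & 3 & -1\\ 1 & -1 & 3\end{pmatrix}.$$ If $p\ge 3$, the Gross lattice of every supersingular elliptic curve over $\overline{\mathbb{F}}_p$ is neither orthogonal nor well-rounded.
   Context: $B_p$ is the quaternion algebra over $\mathbb{Q}$ ramified exactly at $p$ and $\infty$, with standard involution $x\mapsto\overline{x}$, $\mathrm{trd}(x)=x+\overline{x}$, $\mathrm{nrd}(x)=x\overline{x}$, inner product $(x,y)=\frac12\mathrm{trd}(x\overline{y})$, $\|x\|^2=\mathrm{nrd}(x)$. For a supersingular elliptic curve $E$ over $\overline{\mathbb{F}}_p$, $\mathrm{End}(E)$ is isomorphic to a maximal order $\mathcal{O}$ of $B_p$, and its Gross lattice is $\mathcal{O}^T=\{2x-\mathrm{trd}(x):x\in\mathcal{O}\}$. Successive minima (non-standard convention): $D_i$ is the smallest value such that the $\mathbb{Z}$-span of $\{x\in\mathcal{O}^T:\|x\|^2\le D_i\}$ has rank at least $i$. A successive minimal basis is an ordered $\mathbb{Z}$-basis $\{\beta_1,\beta_2,\beta_3\}$ with $\|\beta_i\|^2=D_i$; it is normalized if $(\beta_1,\beta_2)\ge0$ and $(\beta_1,\beta_3)\ge0$; its Gram matrix is $((\beta_i,\beta_j))$. A lattice is orthogonal if it has a $\mathbb{Z}$-basis whose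 elements are pairwise orthogonal; a rank-$n$ lattice is well-rounded if it has $n$ linearly independent vectors of minimal nonzero norm, i.e. all its successive minima are equal. *)

(* Defs.v *)
From HB Require Import structures.
From mathcomp Require Import all_boot all_order all_algebra.
Set Implicit Arguments. Unset Strict Implicit. Unset Printing Implicit Defensive.
Import Order.TTheory GRing.Theory Num.Theory.
Local Open Scope ring_scope.

(* The quaternion algebra (a,b)_Q with Q-basis 1, i, j, k = ij,
   i^2 = a, j^2 = b, ji = -ij; an element x0 + x1 i + x2 j + x3 k
   is represented by the row vector (x0, x1, x2, x3). *)
Definition quat := 'rV[rat]_4.

Definition qc (x : quat) (n : nat) : rat := x ord0 (inord n).

Definition mkq (x0 x1 x2 x3 : rat) : quat :=
  \row_(k < 4) nth 0 [:: x0; x1; x2; x3] k.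

Definition qone : quat := mkq 1 0 0 0.

Definition qmul (a b : int) (x y : quat) : quat :=
  let A : rat := a%:~R in let B : rat := b%:~R in
  let x0 := qc x 0 in let x1 := qc x 1 in let x2 := qc x 2 in let x3 := qc x 3 in
  let y0 := qc y 0 in let y1 := qc y 1 in let y2 := qc y 2 in let y3 := qc y 3 in
  mkq (x0 * y0 + A * x1 * y1 + B * x2 * y2 - A * B * x3 * y3)
      (x0 * y1 + x1 * y0 - B * x2 * y3 + B * x3 * y2)
      (x0 * y2 + x2 * y0 + A * x1 * y3 - A * x3 * y1)
      (x0 * y3 + x3 * y0 + x1 * y2 - x2 * y1).

Definition qconj (x : quat) : quat := mkq (qc x 0) (- qc x 1) (- qc x 2) (- qc x 3).

(* trd(x) = x + conj x and nrd(x) = x conj x are scalars; we return the scalar *)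
Definition qtrd (x : quat) : rat := qc (x + qconj x) 0.
Definition qnrd (a b : int) (x : quat) : rat := qc (qmul a b x (qconj x)) 0.
Definition qinner (a b : int) (x y : quat) : rat := qtrd (qmul a b x (qconj y)) / 2.

(* (a,b)_Q is split at the prime l iff its reduced norm form
   x0^2 - a x1^2 - b x2^2 + ab x3^2 is isotropic over Q_l, which (by compactness
   of Z_l) holds iff for every k there is a primitive integer vector on which
   the form vanishes modulo l^k. *)
Definition split_at (l : nat) (a b : int) : Prop :=
  forall k : nat, exists x0 x1 x2 x3 : int,
    ~~ [&& (l%:Z %| x0)%Z, (l%:Z %| x1)%Z, (l%:Z %| x2)%Z & (l%:Z %| x3)%Z] /\
    ((l ^ k)%:Z %| x0 ^+ 2 - a * x1 ^+ 2 - b * x2 ^+ 2 + a * b * x3 ^+ 2)%Z.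

Definition ramified_at (l : nat) (a b : int) : Prop := ~ split_at l a b.

(* ramified at infinity: B tensor R is a division algebra, i.e. the reduced
   norm form is (positive) definite. *)
Definition ramified_inf (a b : int) : Prop :=
  forall x : quat, x != 0 -> 0 < qnrd a b x.

Definition is_Bp (p : nat) (a b : int) : Prop :=
  a != 0 /\ b != 0 /\ ramified_inf a b /\
  forall l : nat, prime l -> (ramified_at l a b <-> l = p).

Definition full_lattice (O : quat -> Prop) : Prop :=
  exists e : 'M[rat]_4, e \in unitmx /\
    forall x, O x <-> exists n : 'rV[int]_4, x = map_mx (fun z : int => z%:~R) n *m e.

Definition order (a b : int) (O : quat -> Prop) : Prop :=
  full_lattice O /\ O qone /\ forall x y, O x -> O y -> O (qmul a b x y).

Definition maximal_order (a b : int) (O : quat -> Prop) : Prop :=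
  order a b O /\
  forall O', order a b O' -> (forall x, O x -> O' x) -> forall x, O' x -> O x.

Definition gross_lattice (O : quat -> Prop) : quat -> Prop :=
  fun y => exists x, O x /\ y = 2%:R *: x - qtrd x *: qone.

Definition vmx n (v : 'I_n -> quat) : 'M[rat]_(n, 4) := \matrix_(i < n, j < 4) v i ord0 j.

Definition span_rank_ge (S : quat -> Prop) (n : nat) : Prop :=
  exists v : 'I_n -> quat, (forall i, S (v i)) /\ row_free (vmx v).

Definition is_succ_min (a b : int) (L : quat -> Prop) (i : nat) (D : rat) : Prop :=
  span_rank_ge (fun x => L x /\ qnrd a b x <= D) i /\
  forall D', D' < D -> ~ span_rank_ge (fun x => L x /\ qnrd a b x <= D') i.

Definition Zbasis (L : quat -> Prop) (beta : 'I_3 -> quat) : Prop :=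
  row_free (vmx beta) /\
  forall x, L x <-> exists n : 'I_3 -> int, x = \sum_(i < 3) beta i *~ n i.

Definition succ_min_basis (a b : int) (L : quat -> Prop) (beta : 'I_3 -> quat) : Prop :=
  Zbasis L beta /\ forall i : 'I_3, is_succ_min a b L i.+1 (qnrd a b (beta i)).

Definition normalized_smb (a b : int) (L : quat -> Prop) (beta : 'I_3 -> quat) : Prop :=
  succ_min_basis a b L beta /\
  0 <= qinner a b (beta 0) (beta 1) /\ 0 <= qinner a b (beta 0) (beta 2%:R).

Definition gram (a b : int) (beta : 'I_3 -> quat) : 'M[rat]_3 :=
  \matrix_(i < 3, j < 3) qinner a b (beta i) (beta j).

Definition orthogonal_lattice (a b : int) (L : quat -> Prop) : Prop :=
  exists beta, Zbasis L beta /\ forall i j, i != j -> qinner a b (beta i) (beta j) = 0.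

Definition well_rounded3 (a b : int) (L : quat -> Prop) : Prop :=
  exists v : 'I_3 -> quat, (forall i, L (v i)) /\ row_free (vmx v) /\
    forall i x, L x -> x != 0 -> qnrd a b (v i) <= qnrd a b x.

Definition gram_p2 : 'M[rat]_3 :=
  \matrix_(i < 3, j < 3)
    nth 0 (nth [::] [:: [:: 3; 1; 1]; [:: 1; 3; -1]; [:: 1; -1; 3]] i) j.

(* Main.v *)
(** Write [G] for the Gram matrix of the Gross lattice in the basis
    [2 x_i - trd x_i], where [1, x1, x2, x3] is a basis of [O].  Then
    [det G = 4 t^2] with [t = trd (x1 * conj [x2, x3])], and the 2x2 minors of
    [G] are reduced traces of products of commutators of the [x_i].

    Let [l] be a prime dividing [t].  The radical of the trace form modulo [l]
    contains some [j] outside [l O] with [l | nrd j].  Maximality of [O] forces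
    an [x] in the radical with [l^2 | nrd x] to lie in [l O], since otherwise
    [O + O (x / l)] is a larger order.  Applied to multiples of [j], this shows
    that [l^2 | nrd x] implies [x] in [l O] for every [x] in [O], so that the
    algebra is ramified at [l] and [l = p]; that commutators have norm divisible
    by [p]; and that [p^2] does not divide [t].  Hermite reduction excludes
    [t^2 = 1], the norms of nonzero elements being at least 3.  Hence
    [det G = 4 p^2], and [4 p] divides the principal 2x2 minors.

    For an orthogonal basis the product of these three minors is
    [16 p^4], yet it is divisible by [64 p^3].  For a well-rounded lattice the
    minimal vectors form a basis, and after sign changes the off-diagonal entries
    are [D - 2 p u], [D - 2 p v], [D - 2 p w]; with [X = v + w - u],
    [Y = u + w - v], [Z = u + v - w] (odd and positive), minimality and
    [det G = 4 p^2] give [p X Y Z <= 2].  For [p = 2], Hermite reduction gives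
    a basis of vectors of norm 3. *)
Require Import Defs.
From HB Require Import structures.
From mathcomp Require Import all_boot all_order all_algebra.
From mathcomp Require Import ring lra zify.
Set Implicit Arguments. Unset Strict Implicit. Unset Printing Implicit Defensive.
Import Order.TTheory GRing.Theory Num.Theory.
Local Open Scope ring_scope.

(** * Quaternion identities *)

Lemma qcD x y n : qc (x + y) n = qc x n + qc y n. Proof. by rewrite /qc mxE. Qed.
Lemma qcN x n : qc (- x) n = - qc x n. Proof. by rewrite /qc mxE. Qed.
Lemma qcZ c x n : qc (c *: x) n = c * qc x n. Proof. by rewrite /qc mxE. Qed.
Lemma qc0 n : qc 0 n = 0. Proof. by rewrite /qc mxE. Qed.

Lemma qc_mkq x0 x1 x2 x3 :
  (qc (mkq x0 x1 x2 x3) 0 = x0) * (qc (mkq x0 x1 x2 x3) 1 = x1) *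
  (qc (mkq x0 x1 x2 x3) 2 = x2) * (qc (mkq x0 x1 x2 x3) 3 = x3).
Proof. by rewrite /qc !mxE !inordK. Qed.

Lemma quat_ext x y :
  qc x 0 = qc y 0 -> qc x 1 = qc y 1 -> qc x 2 = qc y 2 -> qc x 3 = qc y 3 -> x = y.
Proof.
move=> h0 h1 h2 h3; apply/rowP => i.
rewrite -(inord_val i); move: h0 h1 h2 h3; rewrite /qc.
by case: i => [[|[|[|[|i]]]] hi].
Qed.

Lemma scale_int (V : lmodType rat) (x : V) (n : int) : x *~ n = n%:~R *: x.
Proof. by rewrite scaler_int. Qed.

Definition qcE := (scale_int, qcD, qcN, qcZ, qc0, qc_mkq).

(* Abstracting the coordinates keeps [ring] from comparing them up to conversion. *)
Ltac abstract_coordinates :=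
  repeat match goal with
  | |- context [qc ?x ?n] => let c := fresh "c" in move: (qc x n) => c
  | |- context [(?m%:~R)] => is_var m; let c := fresh "c" in move: (m%:~R) => c
  end.

Ltac qring :=
  rewrite /qinner /qtrd /qnrd; try apply: quat_ext;
  rewrite /qone /qmul /qconj !qcE; abstract_coordinates;
  first [ring | field; try by []].

Section Algebra.
Variables a b : int.
Local Notation "x ** y" := (qmul a b x y) (at level 40, left associativity).
Local Notation N := (qnrd a b).
Local Notation tr := qtrd.
Local Notation cj := qconj.

Lemma qmulA x y z : x ** (y ** z) = x ** y ** z. Proof. qring. Qed.
Lemma qmul1 x : x ** qone = x. Proof. qring. Qed.
Lemma qtrd_mul_conjE x y : tr (x ** cj y) =
  2 * (qc x 0 * qc y 0 - a%:~R * (qc x 1 * qc y 1) - b%:~R * (qc x 2 * qc y 2)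
       + a%:~R * b%:~R * (qc x 3 * qc y 3)).
Proof. qring. Qed.
Lemma qmul1l x : qone ** x = x. Proof. qring. Qed.
Lemma qmulDl x y z : (x + y) ** z = x ** z + y ** z. Proof. qring. Qed.
Lemma qmulDr x y z : z ** (x + y) = z ** x + z ** y. Proof. qring. Qed.
Lemma qmulZl c x y : (c *: x) ** y = c *: (x ** y). Proof. qring. Qed.
Lemma qmulZr c x y : x ** (c *: y) = c *: (x ** y). Proof. qring. Qed.
Lemma qmulNl x y : (- x) ** y = - (x ** y). Proof. qring. Qed.
Lemma qmulNr x y : x ** (- y) = - (x ** y). Proof. qring. Qed.
Lemma qconjE x : cj x = tr x *: qone - x. Proof. qring. Qed.
Lemma qconjM x y : cj (x ** y) = cj y ** cj x. Proof. qring. Qed.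
Lemma qconjK x : cj (cj x) = x. Proof. qring. Qed.
Lemma qtrdD x y : tr (x + y) = tr x + tr y. Proof. qring. Qed.
Lemma qtrdZ c x : tr (c *: x) = c * tr x. Proof. qring. Qed.
Lemma qtrd1 : tr qone = 2. Proof. qring. Qed.
Lemma qnrdM x y : N (x ** y) = N x * N y. Proof. qring. Qed.
Lemma qnrdZ c x : N (c *: x) = c ^+ 2 * N x. Proof. qring. Qed.
Lemma qnrd1 : N qone = 1. Proof. qring. Qed.
Lemma qnrd_conj x : N (cj x) = N x. Proof. qring. Qed.
Lemma qmul_conj x : x ** cj x = N x *: qone. Proof. qring. Qed.
Lemma qconj_mul x : cj x ** x = N x *: qone. Proof. qring. Qed.
Lemma qtrd_mulC x y : tr (x ** y) = tr (y ** x). Proof. qring. Qed.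

Definition commutator (x y : quat) : quat := x ** y - y ** x.

(** Up to signs and the weights [a] and [b], a commutator is twice the cross product of the pure
    parts. *)
Lemma commutatorE x y : commutator x y =
  mkq 0 (- 2 * b%:~R * (qc x 2 * qc y 3 - qc x 3 * qc y 2))
        (2 * a%:~R * (qc x 1 * qc y 3 - qc x 3 * qc y 1))
        (2 * (qc x 1 * qc y 2 - qc x 2 * qc y 1)).
Proof. rewrite /commutator; qring. Qed.

Lemma commutator_conj x y : commutator (cj x) (cj y) = commutator x y.
Proof. by rewrite !commutatorE /qconj !qcE !mulrNN. Qed.

End Algebra.

(** * Integrality and divisibility of rationals *)

Notation Zint x := ((x : rat) \is a Num.int).

Lemma ZintD x y : Zint x -> Zint y -> Zint (x + y). Proof. exact: rpredD. Qed.
Lemma ZintN x : Zint x -> Zint (- x). Proof. by rewrite rpredN. Qed.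
Lemma ZintM x y : Zint x -> Zint y -> Zint (x * y). Proof. exact: rpredM. Qed.
Lemma ZintX x n : Zint x -> Zint (x ^+ n). Proof. exact: rpredX. Qed.
Lemma Zint_int (n : int) : Zint n%:~R. Proof. exact: intr_int. Qed.
Lemma Zint_nat (n : nat) : Zint n%:R. Proof. exact: rpred_nat. Qed.
Lemma Zint1 : Zint 1. Proof. exact: rpred1. Qed.

Ltac zint := repeat first
  [ assumption | exact: Zint_int | exact: Zint_nat | exact: Zint1
  | apply: ZintM | apply: ZintN | apply: ZintD | apply: ZintX ].

(** Norms and traces are rationals, so divisibility is encoded as integrality of the quotient; a
    proof of [divQ l x] also serves later as a proof that [x / l] is an integer. *)
Definition divQ (l : nat) (x : rat) : bool := x / l%:R \is a Num.int.

Lemma divQ_int l (n : int) : (0 < l)%N -> divQ l n%:~R = (l%:Z %| n)%Z.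
Proof.
move=> l0; have l0' : (l%:R : rat) != 0 by rewrite pnatr_eq0 -lt0n.
apply/idP/dvdzP => [/intrP[m hm]|[q ->]].
  exists m; apply: (@intr_inj rat); rewrite intrM -hm /= -pmulrn.
  by rewrite divfK.
by rewrite /divQ intrM -pmulrn mulfK // intr_int.
Qed.

Lemma divQD l x y : divQ l x -> divQ l y -> divQ l (x + y).
Proof. by rewrite /divQ mulrDl; apply: rpredD. Qed.

Lemma divQN l x : divQ l (- x) = divQ l x.
Proof. by rewrite /divQ mulNr rpredN. Qed.

Lemma divQB l x y : divQ l x -> divQ l y -> divQ l (x - y).
Proof. by move=> hx hy; rewrite divQD ?divQN. Qed.

Lemma divQM l x y : Zint x -> divQ l y -> divQ l (x * y).
Proof. by rewrite /divQ -mulrA; apply: rpredM. Qed.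

Lemma divQMM l k x y : divQ l x -> divQ k y -> divQ (l * k) (x * y).
Proof.
rewrite /divQ natrM => hx hy.
have -> : x * y / (l%:R * k%:R) = (x / l%:R) * (y / k%:R) by rewrite invfM; ring.
exact: rpredM.
Qed.

Lemma divQ_self l x : (0 < l)%N -> Zint x -> divQ l (l%:R * x).
Proof. by move=> l0 hx; rewrite /divQ mulrC mulKf // pnatr_eq0 -lt0n. Qed.

Lemma divQ_sqr l x : (0 < l)%N -> divQ (l ^ 2) x -> divQ l x.
Proof.
move=> l0; have l0' : (l%:R : rat) != 0 by rewrite pnatr_eq0 -lt0n.
rewrite /divQ => h; have -> : x / l%:R = l%:R * (x / (l ^ 2)%:R).
  by rewrite natrX; field.
by rewrite rpredM ?rpred_nat.
Qed.

Lemma one_mul (R : pzRingType) (y : R) s : s = 1 -> y = s * y.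
Proof. by move=> ->; rewrite mul1r. Qed.

Section Prime.
Variables (l : nat) (hl : prime l).
Let l0 : (0 < l)%N. Proof. exact: prime_gt0. Qed.
Let l0' : (l%:R : rat) != 0. Proof. by rewrite pnatr_eq0 -lt0n. Qed.

Lemma divQ_bezout x : Zint x -> ~~ divQ l x ->
  exists u v, Zint u /\ Zint v /\ u * x + v * l%:R = 1.
Proof.
move=> /intrP[n ->]; rewrite divQ_int // => h.
have : coprimez n l%:Z.
  by rewrite coprimezE /= coprime_sym prime_coprime // ; move: h; rewrite dvdzE.
case/coprimezP => [[u v] /= e]; exists u%:~R, v%:~R; split; last split; rewrite ?intr_int //.
by rewrite -[RHS]/(1%:~R) -e rmorphD !rmorphM.
Qed.

Lemma divQ_prime x y : Zint x -> Zint y -> divQ l (x * y) -> divQ l x || divQ l y.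
Proof.
move=> hx hy h; case: (boolP (divQ l x)) => //= nx.
have [u [v [hu [hv e]]]] := divQ_bezout hx nx.
have -> : y = u * (x * y) + l%:R * (v * y) by rewrite {1}(one_mul y e); ring.
by apply: divQD; [apply: divQM | apply: divQ_self => //; apply: rpredM].
Qed.

Lemma divQ_prime2 x y : Zint x -> Zint y -> ~~ divQ l x -> divQ (l ^ 2) (x * y) ->
  divQ (l ^ 2) y.
Proof.
move=> hx hy nx h; have [u [v [hu [hv e]]]] := divQ_bezout hx nx.
have := divQ_prime hx hy (divQ_sqr l0 h); rewrite (negbTE nx) /= => hly.
have -> : y = u * (x * y) + v * (l%:R * y) by rewrite {1}(one_mul y e); ring.
apply: divQD; apply: divQM => //; rewrite expnS expn1; apply: divQMM => //.
by rewrite /divQ divff.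
Qed.

Lemma divQ_prime_sqr x : Zint x -> divQ l (x ^+ 2) -> divQ l x.
Proof. by move=> hx; rewrite expr2 => /(divQ_prime hx hx); rewrite orbb. Qed.

End Prime.

Lemma common_den m n (A : 'M[rat]_(m, n)) :
  exists k : nat, (0 < k)%N /\ forall i j, Zint (k%:R * A i j).
Proof.
pose d (p : 'I_m * 'I_n) := `|denq (A p.1 p.2)|%N.
exists (\prod_p d p)%N; split.
  by apply: prodn_gt0 => p; rewrite /d absz_gt0 denq_neq0.
move=> i j; rewrite (bigD1 (i, j)) //= natrM mulrAC rpredM ?rpred_nat //.
rewrite /d /= -{2}[A i j]divq_num_den mulrC natr_absz gtr0_norm ?denq_gt0 //.
by rewrite divfK ?intr_int // intr_eq0 denq_neq0.
Qed.

(** The denominator [d] of [q] satisfies [d^n | M] for every [n]; at [n = M] this contradicts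
    [M < d^M] unless [d = 1]. *)
Lemma Zint_of_powers (q : rat) (M : nat) : (0 < M)%N ->
  (forall n, Zint (M%:R * q ^+ n)) -> Zint q.
Proof.
move=> M0 h.
have hd n : (`|denq q| ^ n %| M)%N.
  have /intrP[z hz] := h n.
  have dn0 : (denq q)%:~R != 0 :> rat by rewrite intr_eq0 denq_neq0.
  have e : (M%:Z * numq q ^+ n = z * denq q ^+ n)%R.
    apply: (@intr_inj rat); rewrite !rmorphM !rmorphXn /= -pmulrn -hz.
    by rewrite -{2}[q]divq_num_den expr_div_n -!mulrA mulVf ?mulr1 // expf_neq0.
  have : (denq q ^+ n %| M%:Z * numq q ^+ n)%Z by rewrite e dvdz_mull.
  rewrite Gauss_dvdzl; last first.
    rewrite coprimezE !abszX; apply/coprimeXl/coprimeXr.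
    by rewrite coprime_sym coprime_num_den.
  by rewrite dvdzE abszX.
have d1 : `|denq q|%N = 1%N.
  apply/eqP; rewrite eqn_leq absz_gt0 denq_neq0 andbT leqNgt; apply/negP => d2.
  have := dvdn_leq M0 (hd M); rewrite leqNgt => /negP[].
  exact: ltn_expl.
rewrite Qint_def; apply/eqP.
by rewrite -[denq q]gtr0_norm ?denq_gt0 // -abszE d1.
Qed.

(** * Lattices and orders *)

Lemma map_intr_int m n (A : 'M[rat]_(m, n)) :
  (forall i j, Zint (A i j)) -> exists B : 'M[int]_(m, n), A = map_mx intr B.
Proof.
move=> h; exists (\matrix_(i, j) Num.floor (A i j)); apply/matrixP => i j.
by rewrite !mxE; apply/esym/eqP; rewrite -intrEfloor.
Qed.

Lemma full_latticeP (O : quat -> Prop) : full_lattice O <->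
  exists e : 'M[rat]_4, e \in unitmx /\
    forall x, O x <-> forall i, Zint ((x *m invmx e) ord0 i).
Proof.
split=> -[e [ue h]]; exists e; split=> // x; rewrite h; split.
- by case=> n -> i; rewrite -mulmxA mulmxV // mulmx1 mxE intr_int.
- move=> hi; have [i j|n hn] := @map_intr_int _ _ (x *m invmx e).
    by rewrite (ord1 i).
  by exists n; rewrite -[LHS](mulmxKV ue) hn.
- move=> hi; have [i j|n hn] := @map_intr_int _ _ (x *m invmx e).
    by rewrite (ord1 i).
  by exists n; rewrite -[LHS](mulmxKV ue) hn.
- by case=> n -> i; rewrite -mulmxA mulmxV // mulmx1 mxE intr_int.
Qed.

Section Lattice.
Variables (O : quat -> Prop) (hO : full_lattice O).

Lemma lattice_add x y : O x -> O y -> O (x + y).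
Proof.
case/full_latticeP: hO => e [ue h] /h hx /h hy; apply/h => i.
by rewrite mulmxDl mxE rpredD.
Qed.

Lemma lattice_scale c x : Zint c -> O x -> O (c *: x).
Proof.
case/full_latticeP: hO => e [ue h] hc /h hx; apply/h => i.
by rewrite -scalemxAl mxE rpredM.
Qed.

Lemma lattice_opp x : O x -> O (- x).
Proof. by move=> hx; rewrite -scaleN1r; apply: lattice_scale. Qed.

Lemma lattice_sub x y : O x -> O y -> O (x - y).
Proof. by move=> hx hy; apply: lattice_add => //; apply: lattice_opp. Qed.

Lemma lattice0 : O 0.
Proof. by case/full_latticeP: hO => e [ue h]; apply/h => i; rewrite mul0mx mxE. Qed.

(** This and [lattice_mult] say that the lattice is commensurable with the lattice of integer
    coordinates. *)
Lemma lattice_den : exists k : nat, (0 < k)%N /\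
  forall x, O x -> forall n, Zint (k%:R * qc x n).
Proof.
case: hO => e [ue h]; have [k [k0 hk]] := common_den e.
exists k; split => // x /h[n ->] j.
rewrite /qc mxE big_distrr rpred_sum //= => i _.
by rewrite mulrCA mxE rpredM ?intr_int.
Qed.

Lemma lattice_mult : exists k : nat, (0 < k)%N /\
  forall x, (forall n, Zint (qc x n)) -> O (k%:R *: x).
Proof.
case/full_latticeP: hO => e [ue h]; have [k [k0 hk]] := common_den (invmx e).
exists k; split => // x hx; apply/h => i.
rewrite -scalemxAl scalemxAr mxE rpred_sum // => j _.
rewrite [in X in _ * X]mxE rpredM //.
by have := hx j; rewrite /qc inord_val.
Qed.

End Lattice.

(** The subgroup [l Z^k + Z^k X] is free of rank [k]: the Smith form of [l I] stacked on [X] yields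
    a square basis matrix [E]. It makes [O + O z] a full lattice in [maximal_order_div]. *)
Lemma row_span_square k (X : 'M[int]_k) (l : nat) : (0 < l)%N ->
  exists E : 'M[int]_k, map_mx intr E \in (unitmx : pred 'M[rat]_k) /\
    forall v : 'rV[int]_k, (exists n m : 'rV[int]_k, v = l%:Z *: n + m *m X) <->
      exists w : 'rV[int]_k, v = w *m E.
Proof.
move=> l0.
have [L uL [R uR [d _ eM]]] := int_Smith_normal_form (col_mx (l%:Z%:M : 'M_k) X).
pose D1 : 'M[int]_k := \matrix_(i, j) (d`_i *+ (i == j :> nat)).
have eD : \matrix_(i < k + k, j < k) (d`_i *+ (i == j :> nat)) = col_mx D1 0.
  apply/matrixP => i j; rewrite !mxE; case: splitP => i' ei; rewrite !mxE ei //.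
  by rewrite gtn_eqF // (leq_trans (ltn_ord j)) ?leq_addr.
have spanE n m : l%:Z *: n + m *m X = lsubmx (row_mx n m *m L) *m (D1 *m R) :> 'rV_k.
  have -> : l%:Z *: n + m *m X = row_mx n m *m col_mx l%:Z%:M X.
    by rewrite mul_row_col mul_mx_scalar.
  rewrite eM eD !mulmxA; set V := _ *m L.
  by rewrite -{1}[V]hsubmxK mul_row_col mulmx0 addr0.
exists (D1 *m R); split; last first.
  move=> v; split => [[n [m ->]]|[w ->]].
    by exists (lsubmx (row_mx n m *m L)); rewrite spanE.
  exists (lsubmx (row_mx w 0 *m invmx L)), (rsubmx (row_mx w 0 *m invmx L)).
  by rewrite spanE hsubmxK -mulmxA mulVmx // mulmx1 row_mxKl.
pose W := \matrix_(i < k) lsubmx (row_mx (delta_mx 0 i : 'rV_k) (0 : 'rV_k) *m L).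
have eW : W *m (D1 *m R) = l%:Z%:M.
  apply/row_matrixP => i; rewrite row_mul rowK -spanE mul0mx addr0.
  by rewrite rowE mul_mx_scalar.
have : \det (map_mx intr W : 'M[rat]_k) * \det (map_mx intr (D1 *m R) : 'M[rat]_k) != 0.
  rewrite -det_mulmx -map_mxM eW map_scalar_mx det_scalar expf_neq0 //=.
  by rewrite -pmulrn pnatr_eq0 -lt0n.
by rewrite mulf_eq0 negb_or unitmxE unitfE => /andP[].
Qed.

Section Order.
Variables (a b : int) (O : quat -> Prop).
Local Notation "x ** y" := (qmul a b x y) (at level 40, left associativity).
Local Notation N := (qnrd a b).
Local Notation tr := qtrd.
Local Notation cj := qconj.

Section Closure.
Hypothesis hO : Defs.order a b O.
Let latO : full_lattice O. Proof. by case: hO. Qed.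

Lemma order1 : O qone. Proof. by case: hO => _ []. Qed.

Lemma orderM x y : O x -> O y -> O (x ** y).
Proof. by case: hO => _ [_]; apply. Qed.

Definition orderD := lattice_add latO.
Definition orderN := lattice_opp latO.
Definition orderB := lattice_sub latO.
Definition orderZ := lattice_scale latO.

(* The norms of the powers of [x] have bounded denominators. *)
Lemma order_nrd x : O x -> Zint (N x).
Proof.
move=> hx; have [k [k0 hk]] := lattice_den latO.
apply: (@Zint_of_powers _ (k ^ 2)); first by rewrite expn_gt0 k0.
move=> n; pose y := iter n (qmul a b x) qone.
have hy : O y by rewrite /y; elim: (n) => [|m IH]; [exact: order1 | exact: orderM].
have <- : N y = N x ^+ n.
  rewrite /y; clear; elim: n => [|n IH] /=; first by rewrite expr0 qnrd1.
  by rewrite qnrdM IH exprS.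
have -> : (k ^ 2)%:R * N y = (k%:R * qc y 0) ^+ 2 - a%:~R * (k%:R * qc y 1) ^+ 2
   - b%:~R * (k%:R * qc y 2) ^+ 2 + a%:~R * b%:~R * (k%:R * qc y 3) ^+ 2.
  by rewrite natrX; qring.
have hk' := hk y hy.
have [h0 h1 h2 h3] := And4 (hk' 0%N) (hk' 1%N) (hk' 2%N) (hk' 3%N).
by zint.
Qed.

Lemma order_trd x : O x -> Zint (tr x).
Proof.
move=> hx; have -> : tr x = N (x + qone) - N x - 1 by qring.
by rewrite !rpredB ?order_nrd ?rpred1 //; apply: orderD => //; apply: order1.
Qed.

Lemma order_conj x : O x -> O (cj x).
Proof.
move=> hx; rewrite qconjE; apply: orderB => //; apply: orderZ; last exact: order1.
exact: order_trd.
Qed.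

Lemma order_trd_mul x y : O x -> O y -> Zint (tr (x ** cj y)).
Proof. by move=> hx hy; apply/order_trd/orderM/order_conj. Qed.

End Closure.

(* [O + O z] is closed under multiplication: by the polarised identity
   [z y = conj y * z + (element of O)], the product of two of its elements
   reduces to [O z^2 + O z + O], and [z^2] is an integral combination of [1, z]. *)
Lemma maximal_order_div (hO : maximal_order a b O) (l : nat) x :
  (0 < l)%N -> O x -> (forall y, O y -> divQ l (tr (x ** cj y))) ->
  divQ (l ^ 2) (N x) -> O (l%:R^-1 *: x).
Proof.
move=> l0 hx htr hN; case: (hO) => ord max.
have l0' : (l%:R : rat) != 0 by rewrite pnatr_eq0 -lt0n.
set z := _ *: x.
have xz : x = l%:R *: z by rewrite scalerA divff ?scale1r.
have Nz : Zint (N z) by rewrite qnrdZ mulrC exprVn -natrX.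
have tz y : O y -> Zint (tr (z ** cj y)).
  by move=> hy; rewrite qmulZl qtrdZ mulrC; apply: htr.
have tz0 : Zint (tr z).
  have -> : tr z = tr (z ** cj qone) by qring.
  exact/tz/order1.
pose O' w := exists u v, O u /\ O v /\ w = u + v ** z.
apply: (max O') => [|w hw|]; last first.
- exists 0, qone; split; first exact: lattice0 (proj1 ord).
  by split; [exact: order1 | rewrite qmul1l add0r].
- exists w, 0; split => //; split; first exact: lattice0 (proj1 ord).
  by qring.
split; last split.
- case: (ord) => [[e [ue he]] _].
  have rowO i : O (row i e).
    apply/he; exists (delta_mx 0 i); rewrite rowE; congr (_ *m _).
    by apply/matrixP => p q; rewrite !mxE; case: andP.
  (* The matrix of right multiplication by [x] in the basis [e]. It is integral, and in coordinates
     [l (O + O z)] is [l Z^4 + Z^4 X]. *)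
  pose Xr : 'M[rat]_4 := \matrix_i ((row i e ** x) *m invmx e).
  have [i j|X eX] := @map_intr_int _ _ Xr.
    rewrite mxE; have /he[n ->] := orderM ord (rowO i) hx.
    by rewrite -mulmxA mulmxV // mulmx1 mxE intr_int.
  have mulX (m : 'rV[int]_4) : (map_mx intr m *m e) ** x = map_mx intr (m *m X) *m e.
    have lin (w : 'rV[rat]_4) : (w *m e) ** x = w *m Xr *m e.
      rewrite [in LHS](mulmx_sum_row w e) [in RHS](mulmx_sum_row w Xr) mulmx_suml.
      rewrite (big_morph (fun y => y ** x) (fun y y' => qmulDl a b y y' x) (id1 := 0)).
        by apply: eq_bigr => i _; rewrite qmulZl rowK -scalemxAl mulmxKV.
      by qring.
    by rewrite lin eX -map_mxM.
  have [E [uE hE]] := row_span_square X l0.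
  exists (map_mx intr E *m (l%:R^-1 *: e)); split.
    by rewrite unitmx_mul uE unitmxZ // unitfE invr_eq0.
  have step (n m : 'rV[int]_4) : map_mx intr n *m e + (map_mx intr m *m e) ** z
      = map_mx intr (l%:Z *: n + m *m X) *m (l%:R^-1 *: e).
    rewrite /z qmulZr mulX map_mxD map_mxZ mulmxDl -!scalemxAr -scalemxAl.
    by rewrite scalerA /= -pmulrn mulVf // scale1r.
  move=> w; split.
    case=> u [v [/he[n ->] [/he[m ->] ->]]].
    have [|p hp] := (hE (l%:Z *: n + m *m X)).1; first by exists n, m.
    by exists p; rewrite step hp map_mxM -mulmxA.
  case=> p ->; have [|n [m hnm]] := (hE (p *m E)).2; first by exists p.
  exists (map_mx intr n *m e), (map_mx intr m *m e).
  split; first by apply/he; exists n.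
  split; first by apply/he; exists m.
  by rewrite step -hnm map_mxM -mulmxA.
- exists qone, 0; split; first exact: order1.
  split; first exact: lattice0 (proj1 ord).
  by qring.
- move=> w w' [u [v [hu [hv ->]]]] [u' [v' [hu' [hv' ->]]]].
  have swap y : O y -> exists o, O o /\ z ** y = cj y ** z + o.
    move=> hy; exists (tr (z ** y) *: qone - tr z *: cj y); split; last by qring.
    have h1 := order1 ord; have hcy := order_conj ord hy.
    apply: (orderB ord); apply: (orderZ ord) => //.
    by rewrite -[y]qconjK; apply: tz.
  have [o [ho eo]] := swap u' hu'; have [o' [ho' eo']] := swap v' hv'.
  have cu := order_conj ord hu'; have cv := order_conj ord hv'.
  exists (u ** u' + v ** o - N z *: (v ** cj v')).
  exists (u ** v' + v ** cj u' + tr z *: (v ** cj v') + v ** o').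
  split; last split.
  + by apply: (orderB ord); [apply: (orderD ord); apply: orderM
      | apply: (orderZ ord) => //; apply: orderM].
  + by do !apply: (orderD ord); try apply: (orderZ ord) => //; apply: orderM.
  have zz : z ** z = tr z *: z - N z *: qone by qring.
  have -> : (u + v ** z) ** (u' + v' ** z) = u ** u' + u ** v' ** z
      + v ** (z ** u') + v ** (z ** v') ** z.
    by rewrite qmulDl !qmulDr !qmulA !addrA.
  have -> : v ** (z ** v') ** z = v ** cj v' ** (z ** z) + v ** o' ** z.
    by rewrite eo' qmulDr qmulDl !qmulA.
  rewrite eo zz !(qmulDl, qmulDr, qmulZl, qmulNr, qmulZr, qmul1, qmulA).
  by apply: quat_ext; rewrite !qcE; ring.
Qed.

End Order.

(** * Maximal orders at a prime dividing the discriminant *)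

Definition comb (x1 x2 x3 : quat) (c0 c1 c2 c3 : rat) : quat :=
  c0 *: qone + c1 *: x1 + c2 *: x2 + c3 *: x3.

(** Integrality of coordinates also gives linear independence: every rational multiple of a relation
    represents 0, which lies in the lattice [O]. *)
Definition unital_basis (O : quat -> Prop) (x1 x2 x3 : quat) : Prop :=
  (forall c0 c1 c2 c3, O (comb x1 x2 x3 c0 c1 c2 c3) ->
     [/\ Zint c0, Zint c1, Zint c2 & Zint c3]) /\
  (forall x, O x -> exists c0 c1 c2 c3, x = comb x1 x2 x3 c0 c1 c2 c3) /\
  [/\ O x1, O x2 & O x3].

(* The square of [triple x1 x2 x3] is the discriminant of the basis [1, x1, x2, x3]. *)
Definition triple (a b : int) (x1 x2 x3 : quat) : rat :=
  qtrd (qmul a b x1 (qconj (commutator a b x2 x3))).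

Section Trace.
Variables a b : int.
Local Notation "x ** y" := (qmul a b x y) (at level 40, left associativity).
Local Notation cm := (commutator a b).

Ltac cmring :=
  rewrite ?qtrd_mul_conjE !commutatorE /qtrd /qconj ?qcE; abstract_coordinates; ring.

Lemma trd_mul_comb y x1 x2 x3 c0 c1 c2 c3 :
  qtrd (y ** qconj (comb x1 x2 x3 c0 c1 c2 c3)) =
  c0 * qtrd y + c1 * qtrd (y ** qconj x1) + c2 * qtrd (y ** qconj x2)
  + c3 * qtrd (y ** qconj x3).
Proof.
rewrite !qtrd_mul_conjE /comb /qone /qtrd /qconj !qcE; abstract_coordinates; ring.
Qed.

Lemma trd_commutator x y : qtrd (cm x y) = 0.
Proof. by cmring. Qed.

Lemma trd_commutator_l x y : qtrd (cm x y ** qconj x) = 0.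
Proof. by cmring. Qed.

Lemma trd_commutator_r x y : qtrd (cm x y ** qconj y) = 0.
Proof. by cmring. Qed.

Lemma tripleE x1 x2 x3 : triple a b x1 x2 x3 = qtrd (cm x2 x3 ** qconj x1).
Proof. by rewrite /triple; cmring. Qed.

Lemma triple_rot x1 x2 x3 : triple a b x1 x2 x3 = triple a b x2 x3 x1.
Proof. by rewrite /triple; cmring. Qed.

(** Under the trace form the three commutators are orthogonal to 1 and, up to the factor [t], dual
    to [x1, x2, x3]. *)
Lemma trd_commutator_comb x1 x2 x3 c0 c1 c2 c3 :
  let y := qconj (comb x1 x2 x3 c0 c1 c2 c3) in let t := triple a b x1 x2 x3 in
  [/\ qtrd (cm x2 x3 ** y) = c1 * t, qtrd (cm x3 x1 ** y) = c2 * t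
    & qtrd (cm x1 x2 ** y) = c3 * t].
Proof.
rewrite /=; have r1 := triple_rot x1 x2 x3; have r2 := triple_rot x2 x3 x1.
split; rewrite trd_mul_comb trd_commutator trd_commutator_l trd_commutator_r.
- by rewrite tripleE; ring.
- by rewrite r1 tripleE; ring.
- by rewrite r1 r2 tripleE; ring.
Qed.
End Trace.

(** * The order at a prime with a radical vector *)

Section Local.
Variables (a b : int) (O : quat -> Prop).
Local Notation "x ** y" := (qmul a b x y) (at level 40, left associativity).
Local Notation N := (qnrd a b).
Local Notation tr := qtrd.
Local Notation cj := qconj.
Local Notation cm := (commutator a b).
Hypothesis maxO : maximal_order a b O.
Variables (l : nat) (hl : prime l).
Let l0 : (0 < l)%N. Proof. exact: prime_gt0. Qed.
Let l0' : (l%:R : rat) != 0. Proof. by rewrite pnatr_eq0 -lt0n. Qed.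
Let ord : Defs.order a b O. Proof. by case: maxO. Qed.

Definition in_mult (x : quat) : Prop := O (l%:R^-1 *: x).
Local Notation inl := in_mult.

Lemma in_multD x y : inl x -> inl y -> inl (x + y).
Proof. by rewrite /in_mult scalerDr; apply: (orderD ord). Qed.

Lemma in_multB x y : inl x -> inl y -> inl (x - y).
Proof. by rewrite /in_mult scalerBr; apply: (orderB ord). Qed.

Lemma in_multZ c x : Zint c -> inl x -> inl (c *: x).
Proof. by rewrite /in_mult scalerA mulrC -scalerA; apply: (orderZ ord). Qed.

Lemma in_multZd c x : divQ l c -> O x -> inl (c *: x).
Proof. by rewrite /in_mult scalerA mulrC; apply: (orderZ ord). Qed.

Lemma in_mult_unit c x : Zint c -> ~~ divQ l c -> O x -> inl (c *: x) -> inl x.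
Proof.
move=> hc nc hx h; have [u [v [hu [hv e]]]] := divQ_bezout hl hc nc.
have -> : x = u *: (c *: x) + v *: (l%:R *: x).
  by rewrite !scalerA -scalerDl e scale1r.
by apply: in_multD; apply: in_multZ => //; rewrite /in_mult scalerA mulVf // scale1r.
Qed.

Lemma in_multM x y : O x -> inl y -> inl (x ** y).
Proof. by move=> hx; rewrite /in_mult -qmulZr; apply: orderM. Qed.

Lemma in_multMl x y : O x -> inl y -> inl (y ** x).
Proof. by move=> hx; rewrite /in_mult -qmulZl => ?; apply: orderM. Qed.

Lemma in_mult_nrd x : inl x -> divQ (l ^ 2) (N x).
Proof. by move/(order_nrd ord); rewrite qnrdZ mulrC exprVn -natrX. Qed.

Let int1 : O qone. Proof. exact: order1 ord. Qed.

(** A vector of [O] that is nonzero modulo [l] and lies in the radical of the trace form modulo [l];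
    [exists_radical] supplies it. *)
Variable j : quat.
Hypotheses (hj : O j) (jl : ~ inl j) (jN : divQ l (N j))
  (jtr : forall y, O y -> divQ l (tr (j ** cj y))).

(** The product [x j] stays in the radical and its norm is divisible by [l^2], so
    [maximal_order_div] applies. *)
Lemma nrd_mul_radical x : O x -> divQ l (N x) -> inl (x ** j).
Proof.
move=> hx hN; apply: (maximal_order_div maxO l0); first exact: orderM.
  move=> y hy; rewrite -qmulA qtrd_mulC -qmulA -{1}[x]qconjK -qconjM.
  by apply: jtr; apply: orderM => //; apply: (order_conj ord).
by rewrite qnrdM expnS expn1 divQMM.
Qed.

(** Both [x j] and [conj x j] lie in [l O], hence so does [tr x] times [j]; but [j] does not, so
    [tr x] is no unit modulo [l]. *)
Lemma trd_of_nrd x : O x -> divQ l (N x) -> divQ l (tr x).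
Proof.
move=> hx hN; apply/negPn/negP => nt; apply: jl.
apply: (in_mult_unit (order_trd ord hx) nt hj).
have -> : tr x *: j = x ** j + cj x ** j by qring.
apply: in_multD; first exact: nrd_mul_radical.
by apply: nrd_mul_radical; [apply: (order_conj ord) | rewrite qnrd_conj].
Qed.

Lemma trd_mul_of_nrd x y : O x -> divQ l (N x) -> O y -> divQ l (tr (x ** cj y)).
Proof.
move=> hx hN hy; have hcy := order_conj ord hy.
apply: trd_of_nrd; first exact: orderM.
by rewrite qnrdM mulrC divQM // (order_nrd ord).
Qed.

(** Since [trd_mul_of_nrd] puts [x] in the radical, [maximal_order_div] applies. This is the
    anisotropy of the norm form at [l]. *)
Lemma nrd_sqr_in_mult x : O x -> divQ (l ^ 2) (N x) -> inl x.
Proof.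
move=> hx hN; apply: (maximal_order_div maxO l0) => // y hy.
by apply: trd_mul_of_nrd => //; apply: divQ_sqr.
Qed.

Lemma nrd_radical : ~~ divQ l (N j / l%:R).
Proof.
apply/negP => h; apply: jl; apply: nrd_sqr_in_mult => //.
by move: h; rewrite /divQ -mulrA -invfM -natrM.
Qed.

(** Converse of [nrd_mul_radical], by [nrd_sqr_in_mult] applied to [j]: the condition [l | N x]
    amounts to [x j] lying in [l O], which is linear in [x]. *)
Lemma nrd_of_mul_radical x : O x -> inl (x ** j) -> divQ l (N x).
Proof.
move=> hx /in_mult_nrd h; apply/negPn/negP => nx.
apply: jl; apply: nrd_sqr_in_mult => //.
by move: h; rewrite qnrdM; apply: divQ_prime2 => //; apply: (order_nrd ord).
Qed.

(** Modulo [l O], moving [j] across [x] conjugates [x], because the two traces that occur are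
    divisible by [l]. *)
Lemma radical_conj x : O x -> inl (j ** x - cj x ** j).
Proof.
move=> hx; have hcx := order_conj ord hx.
have -> : j ** x - cj x ** j = tr (j ** x) *: qone - tr j *: cj x by qring.
apply: in_multB; apply: in_multZd => //; last exact: trd_of_nrd.
by have := jtr hcx; rewrite qconjK.
Qed.

(** Moving [j] across [x y] at once gives [conj y conj x j], and factor by factor [conj x conj y j].
    Hence the commutator of the conjugates, which equals [[x, y]], multiplies [j] into [l O]. *)
Lemma nrd_commutator x y : O x -> O y -> divQ l (N (cm x y)).
Proof.
move=> hx hy; have hcx := order_conj ord hx; have hcy := order_conj ord hy.
rewrite -commutator_conj; apply: nrd_of_mul_radical.
  by apply: (orderB ord); apply: orderM.
have -> : cm (cj x) (cj y) ** j = (j ** (x ** y) - cj (x ** y) ** j)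
  - (j ** x - cj x ** j) ** y - cj x ** (j ** y - cj y ** j).
  rewrite /commutator qconjM !(qmulDl, qmulDr, qmulNl, qmulNr, qmulA).
  by apply/rowP => i; rewrite !mxE; ring.
apply: in_multB; first apply: in_multB.
- by apply: radical_conj; apply: orderM.
- by apply: in_multMl => //; apply: radical_conj.
- by apply: in_multM => //; apply: radical_conj.
Qed.

(* As [j' * conj j] has norm divisible by [l^2], [j' N(j) / l] lies in [O j]. *)
Lemma radical_generated w x : O w -> O x ->
  divQ l (N w) -> divQ l (N x) -> exists v, O v /\ v ** w = (N w / l%:R) *: x.
Proof.
move=> hw hx Nw Nx; exists (l%:R^-1 *: (x ** cj w)); split; last first.
  by rewrite qmulZl -qmulA qconj_mul qmulZr qmul1 scalerA mulrC.
apply: nrd_sqr_in_mult; first by apply: orderM => //; apply: (order_conj ord).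
by rewrite qnrdM qnrd_conj expnS expn1 divQMM.
Qed.

Section Basis.
Variables (x1 x2 x3 : quat) (bas : unital_basis O x1 x2 x3).

(** Otherwise [O] would be spanned modulo [l] by 1 and [j], against its rank 4. *)
Lemma not_scalar_mod_radical :
  ~ (forall x, O x -> exists n, Zint n /\ divQ l (N (x - n *: qone))).
Proof.
(* An element [y] of norm divisible by [l] is, up to a unit, a multiple [v j]; replacing [v] by the
   integer [n] changes [v j] only within [l O]. *)
move=> H; have rad y : O y -> divQ l (N y) -> exists m, Zint m /\ inl (y - m *: j).
  move=> hy Ny; have [v [hv ev]] := radical_generated hj hy jN Ny.
  have [n [hn Nv]] := H v hv.
  have [u [r [hu [hr e]]]] := divQ_bezout hl (jN : Zint _) nrd_radical.
  exists (u * n); split; first by zint.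
  have -> : y - (u * n) *: j = u *: ((v - n *: qone) ** j) + (r * l%:R) *: y.
    rewrite qmulDl ev qmulNl qmulZl qmul1l {1}(_ : y = (u * (N j / l%:R) + r * l%:R) *: y).
      by apply/rowP => i; rewrite !mxE; ring.
    by rewrite e scale1r.
  apply: in_multD; last by rewrite mulrC; apply: in_multZd => //; apply: divQ_self.
  apply: in_multZ => //; apply: nrd_mul_radical => //.
  by apply: (orderB ord) => //; apply: (orderZ ord).
have lin y : O y -> exists m n, [/\ Zint m, Zint n & inl (y - m *: qone - n *: j)].
  move=> hy; have [m [hm Ny]] := H y hy.
  have [|n [hn h]] := rad _ _ Ny.
    by apply: (orderB ord) => //; apply: (orderZ ord).
  by exists m, n.
have [ind [_ [h1 h2 _]]] := bas.
have [m1 [n1 [hm1 hn1 e1]]] := lin _ h1; have [m2 [n2 [hm2 hn2 e2]]] := lin _ h2.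
have := in_multB (in_multZ hn2 e1) (in_multZ hn1 e2).
(* Eliminating [j] leaves an element of [l O] with coefficient [-n1] at [x2], so [l | n1]; then
   [x1 - m1] lies in [l O], which is absurd. *)
have -> : n2 *: (x1 - m1 *: qone - n1 *: j) - n1 *: (x2 - m2 *: qone - n2 *: j) =
    comb x1 x2 x3 (n1 * m2 - n2 * m1) n2 (- n1) 0.
  by rewrite /comb; apply: quat_ext; rewrite !qcE; ring.
have scomb c c0 c1 c2 c3 : c *: comb x1 x2 x3 c0 c1 c2 c3 =
    comb x1 x2 x3 (c * c0) (c * c1) (c * c2) (c * c3).
  by rewrite /comb; apply: quat_ext; rewrite !qcE; ring.
rewrite /in_mult scomb => /ind[_ _]; rewrite mulrN rpredN mulrC => dn1 _.
have := in_multD e1 (in_multZd dn1 hj); rewrite subrK.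
have -> : x1 - m1 *: qone = comb x1 x2 x3 (- m1) 1 0 0.
  by rewrite /comb; apply: quat_ext; rewrite !qcE; ring.
rewrite /in_mult scomb => /ind[_]; rewrite mulr1 => /intrP[z hz] _ _.
have : (l %| 1)%N.
  have := @divQ_int l 1 l0; rewrite /divQ div1r hz intr_int => /esym.
  by rewrite dvdzE.
by rewrite dvdn1 => /eqP l1; move: hl; rewrite l1.
Qed.

(** First [l | N w], as [tr (w conj w) = 2 N w] and [l^2] does not divide 2. If [l^2 | N w], then
    [nrd_sqr_in_mult] applies. Otherwise [l x] is, up to a unit, a multiple of [w] for every [x],
    which makes the trace form vanish modulo [l]; then [l = 2], and [x] or [x - 1] has even norm,
    contrary to [not_scalar_mod_radical]. *)
Lemma in_mult_of_trd w : O w -> (forall y, O y -> divQ (l ^ 2) (tr (w ** cj y))) -> inl w.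
Proof.
move=> hw htr.
have l2 : ~~ divQ (l ^ 2) 2.
  rewrite (divQ_int 2) ?expn_gt0 ?l0 // dvdzE /=; apply/negP => /dvdn_leq.
  by have := prime_gt1 hl; nia.
have Nw : divQ l (N w).
  apply/negPn/negP => nw; move/negP: l2; apply.
  apply: (divQ_prime2 hl (order_nrd ord hw) (Zint_nat 2) nw).
  by have := htr w hw; rewrite (_ : tr _ = N w * 2) //; qring.
case: (boolP (divQ l (N w / l%:R))) => [h|nu].
  apply: nrd_sqr_in_mult => //.
  by move: h; rewrite /divQ -mulrA -invfM -natrM.
have htr' x y : O x -> O y -> divQ l (tr (x ** cj y)).
  move=> hx hy; have hlx : O (l%:R *: x) by apply: (orderZ ord) => //; zint.
  have Nlx : divQ l (N (l%:R *: x)).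
    by rewrite qnrdZ expr2 -mulrA; apply: divQ_self => //; have := order_nrd ord hx; move=> ?; zint.
  have [v [hv ev]] := radical_generated hw hlx Nw Nlx.
  have hcv := order_conj ord hv.
  have := htr _ (orderM ord hcv hy).
  rewrite qconjM qconjK qmulA qtrd_mulC qmulA ev qmulZl qtrdZ => h.
  have := divQ_prime2 hl (Nw : Zint _) (order_trd_mul ord hlx hy) nu h.
  rewrite qmulZl qtrdZ.
  by rewrite /divQ expnS expn1 natrM invfM mulrACA divff // mul1r.
have l2' : l = 2%N.
  have := htr' _ _ int1 int1; rewrite (_ : tr _ = 2%:~R); last by qring.
  by rewrite divQ_int // dvdzE /= dvdn_prime2 // => /eqP.
case: not_scalar_mod_radical => x hx.
have := htr' _ _ hx int1; rewrite (_ : tr _ = tr x); last by qring.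
case: (boolP (divQ l (N x))) => Nx tx.
  by exists 0; rewrite scale0r subr0; split.
exists 1; rewrite scale1r; split => //.
have -> : N (x - qone) = N x + 1 - tr x by qring.
apply: divQB tx; move: Nx; have /intrP[n ->] := order_nrd ord hx.
rewrite -[1]/(1%:~R) -intrD !divQ_int // l2'; lia.
Qed.

(** If [l^2 | t], duality and [in_mult_of_trd] put all commutators in [l O]. Then [x j], [j x] and
    [conj x j] agree modulo [l O], so [l] divides [N (x - conj x)], which is minus the discriminant
    of the polynomial [N (x - n)] in [n]. That polynomial then has a root modulo [l], contrary to
    [not_scalar_mod_radical]. *)
Lemma triple_not_div_sqr : ~~ divQ (l ^ 2) (triple a b x1 x2 x3).
Proof.
apply/negP => ht; have [ind [gen [h1 h2 h3]]] := bas.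
have cm_in x y : O x -> O y -> O (cm x y).
  by move=> hx hy; apply: (orderB ord); apply: orderM.
have [c23 c31 c12] : [/\ inl (cm x2 x3), inl (cm x3 x1) & inl (cm x1 x2)].
  by split; apply: in_mult_of_trd; try exact: cm_in; move=> y hy;
    have [c0 [c1 [c2 [c3 ey]]]] := gen y hy; move: hy; rewrite ey => /ind[? ? ? ?];
    have [e1 e2 e3] := trd_commutator_comb a b x1 x2 x3 c0 c1 c2 c3;
    first [rewrite e1 | rewrite e2 | rewrite e3];
    apply: divQM.
have cm_gen x y : O x -> O y -> inl (cm x y).
  move=> hx hy.
  have [c0 [c1 [c2 [c3 ex]]]] := gen x hx; move: hx; rewrite ex => /ind[? ? ? ?].
  have [d0 [d1 [d2 [d3 ey]]]] := gen y hy; move: hy; rewrite ey => /ind[? ? ? ?].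
  have -> : cm (comb x1 x2 x3 c0 c1 c2 c3) (comb x1 x2 x3 d0 d1 d2 d3) =
      (c2 * d3 - c3 * d2) *: cm x2 x3 + (c3 * d1 - c1 * d3) *: cm x3 x1
      + (c1 * d2 - c2 * d1) *: cm x1 x2.
    rewrite /commutator /comb !(qmulDl, qmulDr, qmulZl, qmulZr, qmul1, qmul1l).
    by apply/rowP => i; rewrite !mxE; ring.
  by do 2?[apply: in_multD]; apply: in_multZ => //; zint.
apply: not_scalar_mod_radical => x hx.
have Nx : divQ l (N (x - cj x)).
  apply: nrd_of_mul_radical; first by apply: (orderB ord) => //; apply: (order_conj ord).
  have -> : (x - cj x) ** j = cm x j + (j ** x - cj x ** j).
    by rewrite /commutator !(qmulDl, qmulNl); apply: quat_ext; rewrite !qcE; ring.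
  by apply: in_multD; [apply: cm_gen | apply: radical_conj].
have eN : N (x - cj x) = 4 * N x - tr x ^+ 2 by qring.
have eNn n : N (x - n *: qone) = N x - n * tr x + n ^+ 2 by qring.
have [nx hnx] := intrP (order_nrd ord hx).
have [t ht'] := intrP (order_trd ord hx).
move: Nx; rewrite eN hnx ht' -[4]/(4%:~R) -rmorphXn -!rmorphM -rmorphB /= divQ_int // => Nx.
suff [n hn] : exists n : int, (l%:Z %| nx - n * t + n ^+ 2)%Z.
  exists n%:~R; split; first exact: Zint_int.
  by rewrite eNn hnx ht' -rmorphXn -rmorphM -rmorphB -rmorphD /= divQ_int.
have [l2|lodd] := even_prime hl.
  (* For [l = 2] the trace is even, so the parity of the norm decides [n]. *)
  rewrite l2 in Nx *; exists (if (2 %| nx)%Z then 0 else 1).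
  case: ifP => h2'; first by rewrite mul0r expr0n /= addr0 subr0.
  have [q [et|et]] : exists q, t = 2 * q \/ t = 2 * q + 1 by exists (t %/ 2)%Z; lia.
    by rewrite et; lia.
  by move: Nx; rewrite et (_ : (2 * q + 1) ^+ 2 = 4 * (q * q + q) + 1); [lia | ring].
(* [2 n = t] modulo [l], so that [4 (nx - n t + n^2)] is [4 nx - t^2] modulo [l] *)
have cop : coprimez 2%:Z l%:Z by rewrite coprimezE /= coprime2n.
have [[u v] /= uv] := coprimezP _ _ cop.
exists (u * t).
have : (l%:Z %| 4 * (nx - u * t * t + (u * t) ^+ 2))%Z.
  have -> : 4 * (nx - u * t * t + (u * t) ^+ 2) =
     (4 * nx - t ^+ 2) + (v * l%:Z) ^+ 2 * t ^+ 2.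
    have -> : v * l%:Z = 1 - u * 2 by apply/eqP; rewrite eq_sym subr_eq addrC uv.
    by ring.
  by rewrite rpredD // expr2 -!mulrA dvdz_mull // dvdz_mulr.
by rewrite Gauss_dvdzr // coprimezE (_ : `|4|%N = (2 ^ 2)%N) // coprimeXr // coprimen2.
Qed.

End Basis.
End Local.

(** * From the local condition to ramification *)

Section Split.
Variables (a b : int) (O : quat -> Prop) (l : nat).
Hypotheses (ord : Defs.order a b O) (hl : prime l).
Let l0 : (0 < l)%N. Proof. exact: prime_gt0. Qed.
Let l0' : (l%:R : rat) != 0. Proof. by rewrite pnatr_eq0 -lt0n. Qed.

(** Descent: [l^(2k) | N y] gives [y] in [l^k O]. For a primitive integer vector with norm divisible
    by [l^(2k)], a fixed multiple of it is then divisible by [l^k], which is impossible for large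
    [k]. *)
Lemma not_split_at :
  (forall x, O x -> divQ (l ^ 2) (qnrd a b x) -> O (l%:R^-1 *: x)) -> ~ split_at l a b.
Proof.
move=> H split.
have iter k y : O y -> divQ (l ^ k.*2) (qnrd a b y) -> O (l%:R ^- k *: y).
  elim: k y => [|k IH] y hy hN; first by rewrite expr0 invr1 scale1r.
  have q0 : (l ^ k.*2)%:R != 0 :> rat by rewrite natrX expf_neq0.
  have e : (l ^ k.+1.*2 = l ^ k.*2 * l ^ 2)%N by rewrite doubleS -addn2 expnD.
  have hy' : O (l%:R^-1 *: y).
    apply: H => //; move: hN; rewrite /divQ e natrM => h.
    have -> : qnrd a b y / (l ^ 2)%:R =
        (l ^ k.*2)%:R * (qnrd a b y / ((l ^ k.*2)%:R * (l ^ 2)%:R)).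
      by move: (l ^ k.*2)%:R q0 => q q0; rewrite natrX; field; rewrite l0' q0.
    by zint.
  have -> : l%:R ^- k.+1 *: y = l%:R ^- k *: (l%:R^-1 *: y).
    by rewrite scalerA exprS invfM mulrC.
  apply: IH => //; move: hN; rewrite /divQ qnrdZ e natrM.
  have -> // : l%:R^-1 ^+ 2 * qnrd a b y / (l ^ k.*2)%:R =
     qnrd a b y / ((l ^ k.*2)%:R * (l ^ 2)%:R).
  by move: (l ^ k.*2)%:R q0 => q q0; rewrite natrX; field; rewrite l0' q0.
have latO : full_lattice O by case: ord.
have [m [m0 hm]] := lattice_mult latO; have [d [d0 hd]] := lattice_den latO.
(* With [k = d m] one has [l^k > d m], so [l^k | z d m] forces [l | z]. *)
set k := (d * m)%N.
have [y0 [y1 [y2 [y3 [prim dvd]]]]] := split k.*2.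
pose x := mkq y0%:~R y1%:~R y2%:~R y3%:~R.
have hx : O (m%:R *: x).
  apply: hm => n; rewrite /qc /x !mxE.
  by case: (inord n : 'I_4) => [[|[|[|[|i]]]] hi] //=; apply: intr_int.
have Nx : qnrd a b x = (y0 ^+ 2 - a * y1 ^+ 2 - b * y2 ^+ 2 + a * b * y3 ^+ 2)%:~R.
  by rewrite !(rmorphD, rmorphN, rmorphM, rmorphXn) /x /=; qring.
have := iter k _ hx; rewrite qnrdZ Nx => h.
have {}h : O (l%:R ^- k *: (m%:R *: x)).
  apply: h; apply: divQM; first by zint.
  by rewrite divQ_int // expn_gt0 l0.
have key n (z : int) : qc x n = z%:~R -> ((l ^ k)%:Z %| z * k%:Z)%Z.
  move=> ez; have := hd _ h n; rewrite !qcZ ez => hz.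
  rewrite -divQ_int ?expn_gt0 ?l0 // /divQ rmorphM /= -pmulrn natrM natrX.
  by move: hz; congr (is_true (_ \is a Num.int)); ring.
have pr z : ((l ^ k)%:Z %| z * k%:Z)%Z -> (l%:Z %| z)%Z.
  move=> hz; apply/negPn/negP => nz.
  have cop : coprimez (l ^ k)%:Z z.
    by rewrite coprimezE /=; apply: coprimeXl; rewrite prime_coprime // -dvdzE.
  move: hz; rewrite Gauss_dvdzr // dvdzE /= => /dvdn_leq.
  by rewrite muln_gt0 d0 m0 leqNgt ltn_expl ?prime_gt1 // => /(_ isT).
by case/negP: prim; apply/and4P; split; apply: pr;
  [apply: (key 0%N) | apply: (key 1%N) | apply: (key 2%N) | apply: (key 3%N)]; rewrite qcE.
Qed.
End Split.

Lemma det3E (R : comPzRingType) (A : 'M[R]_3) :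
  let A' i j := A (inord i) (inord j) in
  \det A = A' 0%N 0%N * (A' 1%N 1%N * A' 2%N 2%N - A' 1%N 2%N * A' 2%N 1%N)
     - A' 0%N 1%N * (A' 1%N 0%N * A' 2%N 2%N - A' 1%N 2%N * A' 2%N 0%N)
     + A' 0%N 2%N * (A' 1%N 0%N * A' 2%N 1%N - A' 1%N 1%N * A' 2%N 0%N).
Proof.
move=> A'; have eA (i j : 'I_3) : A i j = A' i j by rewrite /A' !inord_val.
rewrite (expand_det_row _ ord0) !big_ord_recl big_ord0 /cofactor.
rewrite !(expand_det_row _ ord0) !big_ord_recl !big_ord0 /cofactor !det_mx11 !mxE !eA.
by rewrite /= /bump /=; clear eA; move: A' => A'; ring.
Qed.

Lemma Fp_intr_eq0 (l : nat) (z : int) : prime l -> ((z%:~R : 'F_l) == 0) = (l%:Z %| z)%Z.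
Proof.
move=> hl; rewrite dvdzE /= (dvdn_pcharf (pchar_Fp hl)).
by case: z => n //=; rewrite NegzE mulrNz oppr_eq0 -pmulrn.
Qed.

(** * Radical vectors of the trace form modulo a prime *)

Section Radical.
Variables (a b : int) (O : quat -> Prop).
Hypothesis ord : Defs.order a b O.
Variables (x1 x2 x3 : quat) (bas : unital_basis O x1 x2 x3).
Local Notation "x ** y" := (qmul a b x y) (at level 40, left associativity).

Let X (i : 'I_4) : quat := nth 0 [:: qone; x1; x2; x3] i.
Let T : 'M[rat]_4 := \matrix_(i, j) qtrd (X i ** qconj (X j)).

(** In the coordinates of 1, i, j, k the trace form is diagonal of determinant [16 a^2 b^2], and
    [triple] is [4 a b] times the determinant of the pure coordinates. *)
Lemma det_trace_form : \det T = triple a b x1 x2 x3 ^+ 2.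
Proof.
pose E : 'M[rat]_4 := \matrix_(i, k) qc (X i) k.
pose D : 'rV[rat]_4 :=
  \row_k nth 0 [:: 2; - 2 * a%:~R; - 2 * b%:~R; 2 * (a%:~R * b%:~R)] k.
have -> : T = E *m diag_mx D *m E^T.
  apply/matrixP => i j; rewrite mul_mx_diag !mxE qtrd_mul_conjE.
  by rewrite !big_ord_recl big_ord0 !mxE /=; abstract_coordinates; ring.
rewrite !det_mulmx det_tr det_diag !big_ord_recl big_ord0 !mxE /=.
have -> : \det E = \det (\matrix_(i < 3, j < 3) qc (X (lift ord0 i)) j.+1).
  rewrite (expand_det_row _ ord0) big_ord_recl big1; last first.
    by case=> [[|[|[|i]]] hi] _ //; rewrite mxE (_ : X ord0 = qone) // /qc /qone mxE inordK ?mul0r.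
  rewrite addr0 mxE /X /qone qcE mul1r /cofactor expr0 mul1r.
  by congr (\det _); apply/matrixP => i j; rewrite !mxE lift0.
rewrite det3E !mxE /X !lift0 !inordK //= /triple.
rewrite qtrd_mul_conjE commutatorE !qcE; abstract_coordinates; ring.
Qed.

(** The trace form has determinant [triple^2], so it is singular modulo [l], and a kernel vector
    over [F_l] lifts to [j]. If [l] does not divide [N j], then all traces vanish modulo [l], so
    [l = 2], and [x1] or [x1 + 1], whichever has even norm, replaces [j]. *)
Lemma exists_radical (l : nat) : prime l -> divQ l (triple a b x1 x2 x3) ->
  exists j, [/\ O j, ~ O (l%:R^-1 *: j), divQ l (qnrd a b j) &
    forall y, O y -> divQ l (qtrd (j ** qconj y))].
Proof.
move=> hl ht; have l0 := prime_gt0 hl.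
have l0' : (l%:R : rat) != 0 by rewrite pnatr_eq0 -lt0n.
have [ind [gen [h1 h2 h3]]] := bas; have int1 := order1 ord.
have hX i : O (X i) by case: i => [[|[|[|[|i]]]] hi].
have [Tz eT] : exists Tz, T = map_mx intr Tz.
  by apply: map_intr_int => i j; rewrite mxE; apply: (order_trd_mul ord).
have tint : Zint (triple a b x1 x2 x3).
  by apply: (order_trd_mul ord) => //; apply: (orderB ord); apply: orderM.
have dT : (l%:Z %| \det Tz)%Z.
  rewrite -divQ_int //; have := det_trace_form; rewrite eT det_map_mx => ->.
  by rewrite expr2 divQM.
have [v v0 vT] : exists2 v : 'rV['F_l]_4, v != 0 & v *m map_mx intr Tz = 0.
  by apply/det0P; rewrite det_map_mx /= Fp_intr_eq0.
pose n (i : 'I_4) : int := (v ord0 i : nat)%:Z.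
have nv i : (n i)%:~R = v ord0 i :> 'F_l by rewrite /n -pmulrn natr_Zp.
pose j := \sum_i (n i)%:~R *: X i.
have ej : j = comb x1 x2 x3 (n 0)%:~R (n 1)%:~R (n 2%:R)%:~R (n 3%:R)%:~R.
  rewrite /j /comb !big_ord_recl big_ord0 addr0 !addrA /X /=.
  by congr (_ + _ + _ + _); congr (_ *: _); congr (n _)%:~R; apply: val_inj.
have jl : ~ O (l%:R^-1 *: j).
  have -> : l%:R^-1 *: j = comb x1 x2 x3 (l%:R^-1 * (n 0)%:~R) (l%:R^-1 * (n 1)%:~R)
       (l%:R^-1 * (n 2%:R)%:~R) (l%:R^-1 * (n 3%:R)%:~R).
    by rewrite ej /comb !scalerDr !scalerA.
  move=> /ind; rewrite ![l%:R^-1 * _]mulrC => -[d0 d1 d2 d3].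
  case/eqP: v0; apply/rowP => i; rewrite mxE -nv; apply/eqP.
  rewrite Fp_intr_eq0 // -divQ_int //.
  case: i => [[|[|[|[|i]]]] hi] //;
    [move: d0|move: d1|move: d2|move: d3]; rewrite /divQ;
    congr (is_true ((n _)%:~R / _ \is a Num.int)); exact: val_inj.
have hj : O j.
  by rewrite ej /comb; do ?apply: (orderD ord); apply: (orderZ ord) => //; zint.
have jtr y : O y -> divQ l (qtrd (j ** qconj y)).
  have tX k : divQ l (qtrd (j ** qconj (X k))).
    have -> : qtrd (j ** qconj (X k)) = (\sum_i n i * Tz i k)%:~R.
      rewrite rmorph_sum /= /j.
      rewrite (big_morph (fun y => qtrd (y ** qconj (X k))) (id1 := 0) (op1 := +%R)).
      - apply: eq_bigr => i _; rewrite qmulZl qtrdZ rmorphM /=; congr (_ * _).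
        by have /matrixP/(_ i k) := eT; rewrite !mxE.
      - by move=> u w; rewrite qmulDl qtrdD.
      - by qring.
    rewrite divQ_int // -Fp_intr_eq0 // rmorph_sum /=.
    have /rowP/(_ k) := vT; rewrite !mxE => e; rewrite -[X in _ == X]e.
    by apply/eqP/eq_bigr => i _; rewrite rmorphM /= nv mxE.
  move=> hy; have [c0 [c1 [c2 [c3 ey]]]] := gen y hy.
  move: hy; rewrite ey => /ind[? ? ? ?]; rewrite trd_mul_comb.
  have t0 := tX 0; rewrite /X /= in t0.
  do ?apply: divQD; apply: divQM => //.
  + by rewrite -[j](qmul1 a b) -[in X in _ ** X](_ : qconj qone = qone) //; qring.
  + exact: (tX 1).
  + exact: (tX 2%:R).
  + exact: (tX 3%:R).
case: (boolP (divQ l (qnrd a b j))) => [Nj|nj]; first by exists j.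
have trl y : O y -> divQ l (qtrd y).
  move=> hy; have := jtr _ (orderM ord (order_conj ord hy) hj).
  rewrite qconjM qconjK qmulA qmul_conj qmulZl qmul1l qtrdZ => h.
  have := divQ_prime hl (order_nrd ord hj) (order_trd ord hy) h.
  by rewrite (negbTE nj).
have l2 : l = 2%N.
  have := trl _ int1; rewrite (_ : qtrd _ = 2%:~R); last by qring.
  by rewrite divQ_int // dvdzE /= dvdn_prime2 // => /eqP.
have good c : Zint c -> divQ l (qnrd a b (x1 + c *: qone)) ->
  exists j, [/\ O j, ~ O (l%:R^-1 *: j), divQ l (qnrd a b j) &
    forall y, O y -> divQ l (qtrd (j ** qconj y))].
  move=> hc hN; have hw : O (x1 + c *: qone).
    by apply: (orderD ord) => //; apply: (orderZ ord).
  exists (x1 + c *: qone); split=> //.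
    have -> : l%:R^-1 *: (x1 + c *: qone) = comb x1 x2 x3 (l%:R^-1 * c) (l%:R^-1) 0 0.
      by rewrite /comb; apply/rowP => i; rewrite !mxE; ring.
    case/ind => _ /intrP[z hz] _ _.
    have : (l %| 1)%N.
      by have := @divQ_int l 1 l0; rewrite /divQ div1r hz intr_int => /esym; rewrite dvdzE.
    by rewrite l2.
  by move=> y hy; apply: trl; apply: orderM => //; apply: (order_conj ord).
case: (boolP (divQ l (qnrd a b x1))) => N1.
  by apply: (good 0); [exact: rpred0 | rewrite scale0r addr0].
apply: (good 1); first exact: rpred1.
have -> : qnrd a b (x1 + 1 *: qone) = qnrd a b x1 + 1 + qtrd x1 by qring.
apply: divQD (trl _ h1); move: N1; have /intrP[z ->] := order_nrd ord h1.
rewrite -[1]/(1%:~R) -intrD !divQ_int // l2; lia.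
Qed.
End Radical.

(** * The Gross lattice and its reduction *)

Definition pure (x : quat) : quat := 2%:R *: x - qtrd x *: qone.

Lemma pureD x y : pure (x + y) = pure x + pure y.
Proof. by rewrite /pure qtrdD; apply/rowP => i; rewrite !mxE; ring. Qed.
Lemma pureZ c x : pure (c *: x) = c *: pure x.
Proof. by rewrite /pure qtrdZ; apply/rowP => i; rewrite !mxE; ring. Qed.
Lemma pure1 : pure qone = 0.
Proof. by rewrite /pure qtrd1; apply/rowP => i; rewrite !mxE; ring. Qed.

(** The form of the Gross lattice pulled back to quaternions along [pure]; scalars lie in its
    kernel. *)
Definition gramG a b x y := qinner a b (pure x) (pure y).

Ltac abstract_gram :=
  repeat match goal with
  | |- context [gramG ?a ?b ?x ?y] => let c := fresh "c" in move: (gramG a b x y) => c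
  end.

Section Gram.
Variables a b : int.
Local Notation "x ** y" := (qmul a b x y) (at level 40, left associativity).
Local Notation N := (qnrd a b).
Local Notation tr := qtrd.
Local Notation cj := qconj.
Local Notation cm := (commutator a b).

Lemma qinnerE x y : qinner a b x y = qtrd (x ** cj y) / 2. Proof. by []. Qed.

Lemma qinnerC x y : qinner a b x y = qinner a b y x.
Proof. by rewrite !qinnerE !qtrd_mul_conjE; ring. Qed.
Lemma qinnerDl x y z : qinner a b (x + y) z = qinner a b x z + qinner a b y z.
Proof. by rewrite !qinnerE !qtrd_mul_conjE !qcE; ring. Qed.
Lemma qinnerZl c x z : qinner a b (c *: x) z = c * qinner a b x z.
Proof. by rewrite !qinnerE !qtrd_mul_conjE !qcE; ring. Qed.
Lemma qinnerDr x y z : qinner a b z (x + y) = qinner a b z x + qinner a b z y.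
Proof. by rewrite !(qinnerC z) qinnerDl. Qed.
Lemma qinnerZr c x z : qinner a b z (c *: x) = c * qinner a b z x.
Proof. by rewrite !(qinnerC z) qinnerZl. Qed.
Lemma qinner_nrd x : qinner a b x x = N x.
Proof. by rewrite qinnerE qtrd_mul_conjE /qnrd /qmul /qconj !qcE; field. Qed.

Local Notation G := (gramG a b).

Lemma gramG_qinner x y : G x y = qinner a b (pure x) (pure y). Proof. by []. Qed.

Lemma gramGC x y : G x y = G y x. Proof. exact: qinnerC. Qed.
Lemma gramGDl x y z : G (x + y) z = G x z + G y z.
Proof. by rewrite /gramG pureD qinnerDl. Qed.
Lemma gramGZl c x z : G (c *: x) z = c * G x z.
Proof. by rewrite /gramG pureZ qinnerZl. Qed.
Lemma gramGDr x y z : G z (x + y) = G z x + G z y.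
Proof. by rewrite /gramG pureD qinnerDr. Qed.
Lemma gramGZr c x z : G z (c *: x) = c * G z x.
Proof. by rewrite /gramG pureZ qinnerZr. Qed.

Lemma gramG_trd x y : G x y = 2 * tr (x ** cj y) - tr x * tr y.
Proof.
by rewrite /gramG qinnerE !qtrd_mul_conjE /pure /qtrd /qconj /qone !qcE; abstract_coordinates; field.
Qed.

Lemma gramG_nrd x : G x x = 4 * N x - tr x ^+ 2.
Proof. by rewrite gramG_trd qmul_conj qtrdZ qtrd1; ring. Qed.

Lemma gramGE x y : G x y = 4 * (- a%:~R * (qc x 1 * qc y 1) - b%:~R * (qc x 2 * qc y 2)
       + a%:~R * b%:~R * (qc x 3 * qc y 3)).
Proof.
by rewrite gramG_trd qtrd_mul_conjE /qtrd /qconj !qcE; abstract_coordinates; ring.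
Qed.

(* Lagrange's identity for the cross product [(pure x, pure y) |-> 2 [x, y]]. *)
Lemma gramG_minor x y z :
  G x x * G y z - G x y * G x z = 2 * tr (cm x y ** cj (cm x z)).
Proof.
by rewrite !gramGE qtrd_mul_conjE !commutatorE !qcE; abstract_coordinates; ring.
Qed.

Lemma gramG_det x y z :
  G x x * G y y * G z z + 2 * G x y * G x z * G y z - G x x * G y z ^+ 2
  - G y y * G x z ^+ 2 - G z z * G x y ^+ 2 = 4 * triple a b x y z ^+ 2.
Proof.
by rewrite !gramGE /triple qtrd_mul_conjE !commutatorE !qcE; abstract_coordinates; ring.
Qed.

(* Gram matrix, scaled by [G x x], of the lattice projected along [pure x]. *)
Definition proj_gram x y z := G x x * G y z - G x y * G x z.
Local Notation M := proj_gram.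

Lemma proj_gramE x y z : M x y z = G x x * G y z - G x y * G x z. Proof. by []. Qed.

Lemma proj_gramDr x y z w : M x y (z + w) = M x y z + M x y w.
Proof. by rewrite /M !gramGDr; abstract_gram; ring. Qed.

Lemma proj_gramZr k x y z : M x y (k *: z) = k * M x y z.
Proof. by rewrite /M !gramGZr; abstract_gram; ring. Qed.

Lemma proj_gramC x y z : M x y z = M x z y.
Proof. by rewrite /M (gramGC y z); abstract_gram; ring. Qed.

Lemma proj_gram_self x y : M x y x = 0.
Proof. by rewrite /M (gramGC y x); abstract_gram; ring. Qed.

Lemma proj_gramSr k x y z : M x y (z + k *: x) = M x y z.
Proof. by rewrite proj_gramDr proj_gramZr proj_gram_self mulr0 addr0. Qed.

Lemma proj_gramSl k x y z : M x (y + k *: x) z = M x y z.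
Proof. by rewrite proj_gramC proj_gramSr proj_gramC. Qed.

(** [pure w] is [G x x] times the component of [pure y] orthogonal to [pure x]; this gives the
    positivity of [M]. *)
Lemma gramG_proj x y : let w := G x x *: y + (- G x y) *: x in
  G w w = G x x * M x y y.
Proof.
rewrite /= gramGDr !gramGZr !gramGDl !gramGZl (gramGC y x) /M.
by abstract_gram; ring.
Qed.

(** Sylvester's identity: the determinant of the 2x2 minors through a corner is the corner times the
    full determinant. *)
Lemma proj_gram_det x y z :
  M x y y * M x z z - M x y z ^+ 2 = G x x * (4 * triple a b x y z ^+ 2).
Proof.
rewrite -gramG_det /M.
by abstract_gram; ring.
Qed.

Lemma triple_coord x1 x2 x3 : triple a b x1 x2 x3 =
  4 * a%:~R * b%:~R * (qc x1 1 * (qc x2 2 * qc x3 3 - qc x2 3 * qc x3 2)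
    - qc x1 2 * (qc x2 1 * qc x3 3 - qc x2 3 * qc x3 1)
    + qc x1 3 * (qc x2 1 * qc x3 2 - qc x2 2 * qc x3 1)).
Proof. by rewrite /triple qtrd_mul_conjE commutatorE !qcE; abstract_coordinates; ring. Qed.

Lemma triple_swap12 x1 x2 x3 : triple a b x2 x1 x3 = - triple a b x1 x2 x3.
Proof. by rewrite !triple_coord; abstract_coordinates; ring. Qed.

Lemma triple_swap23 x1 x2 x3 : triple a b x1 x3 x2 = - triple a b x1 x2 x3.
Proof. by rewrite !triple_coord; abstract_coordinates; ring. Qed.

Lemma triple_shift12 k x1 x2 x3 : triple a b x1 (x2 + k *: x1) x3 = triple a b x1 x2 x3.
Proof. by rewrite !triple_coord !qcE; abstract_coordinates; ring. Qed.

Lemma triple_shift13 k x1 x2 x3 : triple a b x1 x2 (x3 + k *: x1) = triple a b x1 x2 x3.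
Proof. by rewrite !triple_coord !qcE; abstract_coordinates; ring. Qed.

Lemma triple_shift23 k x1 x2 x3 : triple a b x1 x2 (x3 + k *: x2) = triple a b x1 x2 x3.
Proof. by rewrite !triple_coord !qcE; abstract_coordinates; ring. Qed.

End Gram.
Opaque gramG proj_gram.

Lemma Zint_sqr (q : rat) : Zint (q ^+ 2) -> Zint q.
Proof.
move=> h; apply: (@Zint_of_powers _ `|denq q|%N); first by rewrite absz_gt0 denq_neq0.
move=> n; have hd : Zint (`|denq q|%N%:R * q).
  rewrite natr_absz gtr0_norm ?denq_gt0 // -{2}[q]divq_num_den mulrC divfK ?intr_int //.
  by rewrite intr_eq0 denq_neq0.
rewrite -(odd_double_half n) exprD -mul2n exprM mulrA.
by case: (odd n); rewrite ?expr1 ?expr0 ?mulr1; zint.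
Qed.

Lemma scalar_order a b (O : quat -> Prop) c : Defs.order a b O -> O (c *: qone) -> Zint c.
Proof. by move=> ord /(order_nrd ord); rewrite qnrdZ qnrd1 mulr1 => /Zint_sqr. Qed.

(** Scalars in [O] are integers, so 1 is primitive in [O] and extends to a basis; the Smith form of
    its coordinate row provides one. *)
Lemma exists_unital_basis a b (O : quat -> Prop) : Defs.order a b O ->
  exists x1 x2 x3, unital_basis O x1 x2 x3.
Proof.
move=> ord; have [[e [ue he]] [h1 _]] := ord.
have [n0 en0] := (he _).1 h1.
have [L uL [R uR [d _ eM]]] := int_Smith_normal_form n0.
pose f := map_mx intr R *m e.
have uf : f \in unitmx.
  rewrite unitmx_mul ue andbT unitmxE det_map_mx.
  by move: uR; rewrite unitmxE => /(rmorph_unit (intr : {rmorphism int -> rat})).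
have hf x : O x <-> forall i, Zint ((x *m invmx f) ord0 i).
  rewrite he; split.
    case=> n -> i; have -> : map_mx intr n *m e = map_mx intr (n *m invmx R) *m f.
      by rewrite /f mulmxA -map_mxM mulmxKV.
    by rewrite -mulmxA mulmxV // mulmx1 mxE intr_int.
  move=> hi; have [i j|n hn] := @map_intr_int _ _ (x *m invmx f).
    by rewrite (ord1 i).
  by exists (n *m R); rewrite -[LHS](mulmxKV uf) hn map_mxM mulmxA.
pose F i := row i f.
have OF i : O (F i).
  apply/hf => k; rewrite /F rowE -mulmxA mulmxV // mulmx1 mxE.
  by case: (_ && _); rewrite ?rpred0 ?rpred1.
pose c := (L ord0 ord0 * d`_0)%:~R : rat.
have e1 : qone = c *: F ord0.
  rewrite en0 eM map_mxM -mulmxA -/f /F rowE scalemxAl; congr (_ *m _).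
  apply/rowP => k; rewrite !mxE big_ord_recl big_ord0 addr0 !mxE /c eqxx /=.
  by case: k => [[|k] hk]; rewrite ?mulr1n ?mulr0n ?mulr0 ?mulr1.
have c0 : c != 0.
  apply: contra_eq_neq e1 => ->; rewrite scale0r; apply/eqP => /(congr1 (fun x => qc x 0)).
  by rewrite qc0 qcE.
have hc : Zint c^-1.
  by apply: (scalar_order ord); rewrite e1 scalerA mulVf // scale1r.
have combE k0 k1 k2 k3 : comb (F 1) (F 2%:R) (F 3%:R) k0 k1 k2 k3 =
   \row_i nth 0 [:: k0 * c; k1; k2; k3] i *m f.
  rewrite /comb {1}e1 scalerA (mulmx_sum_row _ f) !big_ord_recl big_ord0 addr0 !mxE /=.
  by rewrite !addrA; congr (_ + _ *: _ + _ *: _ + _ *: _); congr (row _ f); apply: val_inj.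
exists (F 1), (F 2%:R), (F 3%:R); split; last split => //.
  move=> k0 k1 k2 k3 /hf; rewrite combE => h.
  have := (h 0, h 1, h 2%:R, h 3%:R); rewrite mulmxK // !mxE /= => -[[[h0 h1'] h2] h3].
  by split=> //; rewrite -[k0](mulfK c0); zint.
move=> x hx; exists ((x *m invmx f) 0 0 / c), ((x *m invmx f) 0 1),
  ((x *m invmx f) 0 2%:R), ((x *m invmx f) 0 3%:R).
rewrite combE -[LHS](mulmxKV uf); congr (_ *m _); apply/rowP => i; rewrite !mxE divfK //.
by case: i => [[|[|[|[|i]]]] hi] //=; apply: eq_bigr => k _; congr (_ * invmx f _ _); apply: val_inj.
Qed.

(** * Bases of the order and of its Gross lattice *)

Section UnitalBasis.
Variables (a b : int) (O : quat -> Prop).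
Hypothesis ord : Defs.order a b O.
Local Notation L := (gross_lattice O).

Lemma comb_pure x1 x2 x3 c0 c1 c2 c3 : pure (comb x1 x2 x3 c0 c1 c2 c3) =
  c1 *: pure x1 + c2 *: pure x2 + c3 *: pure x3.
Proof. by rewrite /comb !pureD !pureZ pure1 scaler0 add0r. Qed.

Lemma unital_basis_indep x1 x2 x3 c1 c2 c3 : unital_basis O x1 x2 x3 ->
  c1 *: pure x1 + c2 *: pure x2 + c3 *: pure x3 = 0 -> [/\ c1 = 0, c2 = 0 & c3 = 0].
Proof.
move=> [ind _] h; have zint_all (c : rat) : (forall q, Zint (q * c)) -> c = 0.
  move=> hc; apply/eqP/negPn/negP => c0; have := hc (2^-1 / c).
  by rewrite divfK.
(* This scalar part makes the combination half of the given relation, hence zero. *)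
pose c0 := - (c1 * qtrd x1 + c2 * qtrd x2 + c3 * qtrd x3) / 2.
have h0 : comb x1 x2 x3 c0 c1 c2 c3 = 0.
  have -> : comb x1 x2 x3 c0 c1 c2 c3 =
      2^-1 *: (c1 *: pure x1 + c2 *: pure x2 + c3 *: pure x3).
    by rewrite /comb /pure /c0; apply/rowP => i; rewrite !mxE; field.
  by rewrite h scaler0.
have hq q : [/\ Zint (q * c0), Zint (q * c1), Zint (q * c2) & Zint (q * c3)].
  apply: ind; have -> : comb x1 x2 x3 (q * c0) (q * c1) (q * c2) (q * c3) =
      q *: comb x1 x2 x3 c0 c1 c2 c3.
    by rewrite /comb; apply/rowP => i; rewrite !mxE; ring.
  by rewrite h0 scaler0; case: ord => latO _; apply: lattice0.
by split; apply: zint_all => q; case: (hq q).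
Qed.

(** The coefficients of the [xi] are read off from pure parts; the remaining scalar lies in [O],
    hence is an integer. *)
Lemma unital_basis_of x1 x2 x3 : [/\ O x1, O x2 & O x3] ->
  (forall c1 c2 c3, c1 *: pure x1 + c2 *: pure x2 + c3 *: pure x3 = 0 ->
     [/\ c1 = 0, c2 = 0 & c3 = 0]) ->
  (forall x, O x -> exists c1 c2 c3, [/\ Zint c1, Zint c2, Zint c3 &
     pure x = c1 *: pure x1 + c2 *: pure x2 + c3 *: pure x3]) ->
  unital_basis O x1 x2 x3.
Proof.
move=> [h1 h2 h3] ind gen; split; last split => //.
- move=> c0 c1 c2 c3 hc; have [d1 [d2 [d3 [hd1 hd2 hd3]]]] := gen _ hc.
  rewrite comb_pure => e.
  have [|/eqP + /eqP + /eqP] := ind (c1 - d1) (c2 - d2) (c3 - d3).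
    rewrite !scalerBl; have -> : forall u v w u' v' w' : quat,
       u - u' + (v - v') + (w - w') = (u + v + w) - (u' + v' + w').
      by move=> *; apply/rowP => i; rewrite !mxE; ring.
    by rewrite e subrr.
  rewrite !subr_eq0 => /eqP e1 /eqP e2 /eqP e3; rewrite e1 e2 e3 in hc *; split=> //.
  apply: (scalar_order ord).
  have -> : c0 *: qone = comb x1 x2 x3 c0 d1 d2 d3 - (d1 *: x1 + d2 *: x2 + d3 *: x3).
    by rewrite /comb; apply/rowP => i; rewrite !mxE; ring.
  apply: (orderB ord) => //.
  by do ?apply: (orderD ord); apply: (orderZ ord).
- move=> x hx; have [c1 [c2 [c3 [_ _ _ e]]]] := gen x hx.
  exists ((qtrd x - c1 * qtrd x1 - c2 * qtrd x2 - c3 * qtrd x3) / 2), c1, c2, c3.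
  rewrite [LHS](_ : x = 2^-1 *: (pure x + qtrd x *: qone)).
    by rewrite e /comb /pure; apply/rowP => i; rewrite !mxE; field.
  by rewrite /pure; apply/rowP => i; rewrite !mxE; field.
Qed.

End UnitalBasis.

Lemma row_free_vmxP n (v : 'I_n -> quat) : row_free (vmx v) <->
  (forall c : 'I_n -> rat, \sum_i c i *: v i = 0 -> forall i, c i = 0).
Proof.
have E (c : 'rV[rat]_n) : c *m vmx v = \sum_i c ord0 i *: v i.
  rewrite mulmx_sum_row; apply: eq_bigr => i _; congr (_ *: _).
  by apply/rowP => k; rewrite !mxE.
split=> [free c hc i|h].
  have : (\row_i c i) *m vmx v = 0 *m vmx v.
    by rewrite mul0mx E -[RHS]hc; apply: eq_bigr => k _; rewrite mxE.
  by move/(row_free_inj free)/rowP/(_ i); rewrite !mxE.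
by apply: inj_row_free => c; rewrite E => /h hc; apply/rowP => i; rewrite hc mxE.
Qed.

Definition vec3 (y1 y2 y3 : quat) (i : 'I_3) : quat := nth 0 [:: y1; y2; y3] i.

Lemma sum_vec3 (V : nmodType) (F : quat -> 'I_3 -> V) y1 y2 y3 :
  \sum_(i < 3) F (vec3 y1 y2 y3 i) i = F y1 0 + F y2 1 + F y3 2%:R.
Proof.
rewrite !big_ord_recl big_ord0 addr0 addrA /vec3 /=.
by congr (_ + F _ _ + F _ _); apply: val_inj.
Qed.

Lemma row_free_vec3 y1 y2 y3 : row_free (vmx (vec3 y1 y2 y3)) <->
  (forall c1 c2 c3, c1 *: y1 + c2 *: y2 + c3 *: y3 = 0 -> [/\ c1 = 0, c2 = 0 & c3 = 0]).
Proof.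
rewrite row_free_vmxP; split=> [h c1 c2 c3 e|h c].
  have := h (fun i => nth 0 [:: c1; c2; c3] i).
  rewrite (sum_vec3 (fun y i => nth 0 [:: c1; c2; c3] i *: y)) /= => /(_ e) hc.
  by split; [apply: (hc 0) | apply: (hc 1) | apply: (hc 2%:R)].
rewrite (sum_vec3 (fun y i => c i *: y)) => /h[e0 e1 e2] i.
by case: i => [[|[|[|i]]] hi] //; [rewrite -[RHS]e0|rewrite -[RHS]e1|rewrite -[RHS]e2];
  congr c; apply: val_inj.
Qed.

Lemma vec3_eta (v : 'I_3 -> quat) : v =1 vec3 (v 0) (v 1) (v 2%:R).
Proof. by case=> [[|[|[|i]]] hi] //=; rewrite /vec3 /=; congr v; apply: val_inj. Qed.

Lemma vmx_ext n (v w : 'I_n -> quat) : v =1 w -> vmx v = vmx w.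
Proof. by move=> e; apply/matrixP => i k; rewrite !mxE e. Qed.

Section ZBasis.
Variables (a b : int) (O : quat -> Prop).
Hypothesis ord : Defs.order a b O.
Local Notation L := (gross_lattice O).

Lemma gross_pure x : O x -> L (pure x).
Proof. by exists x. Qed.

Lemma Zbasis_of_unital x1 x2 x3 : unital_basis O x1 x2 x3 ->
  Zbasis L (vec3 (pure x1) (pure x2) (pure x3)).
Proof.
move=> bas; split.
  by apply/row_free_vec3 => c1 c2 c3; apply: (unital_basis_indep ord bas).
have [ind [gen [h1 h2 h3]]] := bas; move=> y; split.
  case=> x [hx ->]; have [c0 [c1 [c2 [c3 ex]]]] := gen x hx.
  move: (hx); rewrite ex => /ind[_ /intrP[n1 e1] /intrP[n2 e2] /intrP[n3 e3]].
  exists (fun i : 'I_3 => nth 0 [:: n1; n2; n3] i).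
  rewrite (sum_vec3 (fun y i => y *~ nth 0 [:: n1; n2; n3] i)) /=.
  by rewrite -/(pure _) comb_pure e1 e2 e3 !scale_int.
case=> n ->; rewrite (sum_vec3 (fun y i => y *~ n i)) !scale_int -!pureZ -!pureD.
by apply: gross_pure; do ?apply: (orderD ord); apply: (orderZ ord) => //; zint.
Qed.

(** Lifting each vector along [pure] and adjoining 1 turns a basis of the Gross lattice into one of
    [O], so later arguments can use unital bases. *)
Lemma unital_of_Zbasis beta : Zbasis L beta -> exists x1 x2 x3,
  unital_basis O x1 x2 x3 /\ beta =1 vec3 (pure x1) (pure x2) (pure x3).
Proof.
move=> [free gen].
have Lb i : L (beta i).
  apply/gen; exists (fun k => (i == k)%:Z); rewrite (bigD1 i) //= eqxx mulr1z.
  by rewrite big1 ?addr0 // => k; rewrite eq_sym => /negbTE ->; rewrite mulr0z.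
have [x1 [h1 e1]] := Lb 0; have [x2 [h2 e2]] := Lb 1; have [x3 [h3 e3]] := Lb 2%:R.
have eb : beta =1 vec3 (pure x1) (pure x2) (pure x3).
  by move=> i; rewrite [LHS]vec3_eta e1 e2 e3.
exists x1, x2, x3; split=> //; apply: (unital_basis_of ord) => //.
  by apply/row_free_vec3; rewrite -(vmx_ext eb).
move=> x hx; have [n en] := (gen _).1 (gross_pure hx).
exists (n 0)%:~R, (n 1)%:~R, (n 2%:R)%:~R; split; try exact: intr_int.
rewrite en (eq_bigr (fun i => vec3 (pure x1) (pure x2) (pure x3) i *~ n i)).
  by rewrite (sum_vec3 (fun y i => y *~ n i)) !scale_int.
by move=> i _; rewrite eb.
Qed.
End ZBasis.

Lemma Zint_ltS x y : Zint x -> Zint y -> x < y -> x + 1 <= y.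
Proof.
move=> /intrP[m ->] /intrP[n ->]; rewrite ltr_int -[1]/(1%:~R) -intrD ler_int; lia.
Qed.

Lemma ler_half_sqr (q r : rat) : `|2 * q| <= r -> 4 * q ^+ 2 <= r ^+ 2.
Proof.
move=> h; have -> : 4 * q ^+ 2 = `|2 * q| ^+ 2 by rewrite -normrX ger0_norm ?sqr_ge0 //; ring.
by rewrite ler_sqr ?nnegrE // (le_trans _ h).
Qed.

Lemma size_reduce (s D : rat) : 0 < D -> exists k, Zint k /\ `|2 * (s + k * D)| <= D.
Proof.
(* The integer nearest to [s / D], halves rounded up. *)
move=> D0; pose k := Num.floor (s / D + 2^-1).
exists (- k%:~R); split; first by zint.
have := floor_itv (s / D + 2^-1); rewrite -/k intrD => /andP[h1 h2].
have e : s = s / D * D by rewrite divfK // gt_eqF.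
have := ler_wpM2r (ltW D0) h1; have := ler_wpM2r (ltW D0) (ltW h2).
rewrite !mulrDl -e mul1r mulNr => h3 h4.
by rewrite ler_norml; apply/andP; split; lra.
Qed.

(** * Elementary changes of basis and Hermite reduction *)

Section Moves.
Variables (a b : int) (O : quat -> Prop).
Hypothesis ord : Defs.order a b O.

Lemma unital_swap12 x1 x2 x3 : unital_basis O x1 x2 x3 -> unital_basis O x2 x1 x3.
Proof.
have E c0 c1 c2 c3 : comb x2 x1 x3 c0 c1 c2 c3 = comb x1 x2 x3 c0 c2 c1 c3.
  by rewrite /comb; congr (_ + _); rewrite addrAC.
move=> [ind [gen [h1 h2 h3]]]; split; last split => //.
  by move=> c0 c1 c2 c3; rewrite E => /ind[].
by move=> x /gen[c0 [c1 [c2 [c3 ->]]]]; exists c0, c2, c1, c3; rewrite E.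
Qed.

Lemma unital_swap23 x1 x2 x3 : unital_basis O x1 x2 x3 -> unital_basis O x1 x3 x2.
Proof.
have E c0 c1 c2 c3 : comb x1 x3 x2 c0 c1 c2 c3 = comb x1 x2 x3 c0 c1 c3 c2.
  by rewrite /comb addrAC.
move=> [ind [gen [h1 h2 h3]]]; split; last split => //.
  by move=> c0 c1 c2 c3; rewrite E => /ind[].
by move=> x /gen[c0 [c1 [c2 [c3 ->]]]]; exists c0, c1, c3, c2; rewrite E.
Qed.

Lemma unital_add12 k x1 x2 x3 : Zint k ->
  unital_basis O x1 x2 x3 -> unital_basis O x1 (x2 + k *: x1) x3.
Proof.
have E c0 c1 c2 c3 : comb x1 (x2 + k *: x1) x3 c0 c1 c2 c3 =
    comb x1 x2 x3 c0 (c1 + k * c2) c2 c3.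
  by rewrite /comb; apply/rowP => i; rewrite !mxE; ring.
move=> hk [ind [gen [h1 h2 h3]]]; split; last split.
- move=> c0 c1 c2 c3; rewrite E => /ind[? hc ? ?]; split=> //.
  by rewrite -[c1](addrK (k * c2)); zint.
- move=> x /gen[c0 [c1 [c2 [c3 ->]]]]; exists c0, (c1 - k * c2), c2, c3.
  by rewrite E subrK.
- by split=> //; apply: (orderD ord) => //; apply: (orderZ ord).
Qed.

Lemma unital_opp2 x1 x2 x3 : unital_basis O x1 x2 x3 -> unital_basis O x1 (- x2) x3.
Proof.
have E c0 c1 c2 c3 : comb x1 (- x2) x3 c0 c1 c2 c3 = comb x1 x2 x3 c0 c1 (- c2) c3.
  by rewrite /comb; apply/rowP => i; rewrite !mxE; ring.
move=> [ind [gen [h1 h2 h3]]]; split; last split.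
- by move=> c0 c1 c2 c3; rewrite E => /ind[? ? hc ?]; split=> //; rewrite -[c2]opprK; zint.
- by move=> x /gen[c0 [c1 [c2 [c3 ->]]]]; exists c0, c1, (- c2), c3; rewrite E opprK.
- by split=> //; apply: (orderN ord).
Qed.

Lemma unital_add13 k x1 x2 x3 : Zint k ->
  unital_basis O x1 x2 x3 -> unital_basis O x1 x2 (x3 + k *: x1).
Proof. by move=> hk /unital_swap23/(unital_add12 hk)/unital_swap23. Qed.

Lemma unital_add23 k x1 x2 x3 : Zint k ->
  unital_basis O x1 x2 x3 -> unital_basis O x1 x2 (x3 + k *: x2).
Proof. by move=> hk /unital_swap12/(unital_add13 hk)/unital_swap12. Qed.

Lemma unital_opp3 x1 x2 x3 : unital_basis O x1 x2 x3 -> unital_basis O x1 x2 (- x3).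
Proof. by move=> /unital_swap23/unital_opp2/unital_swap23. Qed.

End Moves.

Section Reduction.
Variables (a b : int) (O : quat -> Prop).
Hypotheses (ord : Defs.order a b O) (pos : ramified_inf a b).
Local Notation G := (gramG a b).
Local Notation T := (triple a b).

Lemma gramG_int x y : O x -> O y -> Zint (G x y).
Proof.
move=> hx hy; rewrite gramG_trd.
have ? := order_trd_mul ord hx hy; have ? := order_trd ord hx; have ? := order_trd ord hy.
have h2 : Zint 2 := Zint_nat 2; zint.
Qed.

Lemma gramG_gt0 x : pure x != 0 -> 0 < G x x.
Proof. by rewrite gramG_qinner qinner_nrd => /pos. Qed.

(** The norm is [4 N x - (tr x)^2], which is positive and congruent to 0 or 3 modulo 4. *)
Lemma gramG_ge3 x : O x -> pure x != 0 -> 3 <= G x x.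
Proof.
move=> hx /gramG_gt0; rewrite gramG_nrd.
have /intrP[n ->] := order_nrd ord hx; have /intrP[t ->] := order_trd ord hx.
rewrite -[4]/(4%:~R) -[3]/(3%:~R) -rmorphXn -rmorphM -rmorphB /= ltr0z ler_int.
have [q [->|->]] : exists q, t = 2 * q \/ t = 2 * q + 1 by exists (t %/ 2)%Z; lia.
  by rewrite (_ : (2 * q) ^+ 2 = 4 * (q * q)); [lia | ring].
by rewrite (_ : (2 * q + 1) ^+ 2 = 4 * (q * q + q) + 1); [lia | ring].
Qed.

Local Notation M := (proj_gram a b).

Lemma unital_pure_neq0 x1 x2 x3 : unital_basis O x1 x2 x3 ->
  [/\ pure x1 != 0, pure x2 != 0 & pure x3 != 0].
Proof.
move=> bas; have ind c1 c2 c3 := @unital_basis_indep _ _ _ ord _ _ _ c1 c2 c3 bas.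
split; apply/eqP => e.
- by have [|/eqP] := ind 1 0 0; rewrite ?e ?scale0r ?scaler0 ?addr0.
- by have [|_ /eqP] := ind 0 1 0; rewrite ?e ?scale0r ?scaler0 ?addr0.
- by have [|_ _ /eqP] := ind 0 0 1; rewrite ?e ?scale0r ?scaler0 ?addr0.
Qed.

Lemma proj_gram_gt0 x1 x2 x3 : unital_basis O x1 x2 x3 -> 0 < M x1 x2 x2.
Proof.
move=> bas; have [/gramG_gt0 n1 _ _] := unital_pure_neq0 bas.
pose y := G x1 x1 *: x2 + (- G x1 x2) *: x1.
have y0 : pure y != 0.
  apply/eqP => e; have [|_ /eqP] := @unital_basis_indep _ _ _ ord _ _ _ (- G x1 x2) (G x1 x1) 0 bas.
    by rewrite scale0r addr0 addrC -!pureZ -pureD.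
  by rewrite gt_eqF.
by have := gramG_gt0 y0; rewrite gramG_proj pmulr_rgt0.
Qed.

(** Hermite reduction: the binary form projected along [x1] is Gauss reduced, and [x2], [x3] are
    size-reduced against [x1], which is no longer than [x2]. *)
Definition reduced x1 x2 x3 :=
  [/\ G x1 x1 <= G x2 x2, M x1 x2 x2 <= M x1 x3 x3, `|2 * M x1 x2 x3| <= M x1 x2 x2,
    `|2 * G x1 x2| <= G x1 x1 & `|2 * G x1 x3| <= G x1 x1].

(** After size reduction a violated inequality is repaired by a swap. Swapping [x2, x3] keeps
    [G x1 x1] and lowers the integer [M x1 x2 x2]; swapping [x1, x2] lowers the integer [G x1 x1].
    Hence the nested induction on bounds. *)
Lemma exists_reduced x1 x2 x3 : unital_basis O x1 x2 x3 ->
  exists y1 y2 y3, [/\ unital_basis O y1 y2 y3, reduced y1 y2 y3 &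
    T y1 y2 y3 ^+ 2 = T x1 x2 x3 ^+ 2].
Proof.
have nat_bound (q : rat) : exists n : nat, q <= n%:R.
  exists (Num.bound `|q|).
  exact: le_trans (ler_norm q) (ltW (archi_boundP (normr_ge0 q))).
move=> bas; have [n hn] := nat_bound (G x1 x1).
have [m hm] := nat_bound (M x1 x2 x2).
elim: n m x1 x2 x3 bas hn hm => [|n IHn] m x1 x2 x3 bas.
  by have [/gramG_gt0/lt_geF -> _ _] := unital_pure_neq0 bas.
elim: m x1 x2 x3 bas => [|m IHm] x1 x2 x3 bas hn.
  by rewrite (lt_geF (proj_gram_gt0 bas)).
move=> hm; have [/gramG_gt0 n1 _ _] := unital_pure_neq0 bas.
have [k1 [hk1 s1]] := size_reduce (G x1 x2) n1.
pose y2 := x2 + k1 *: x1; have bas1 : unital_basis O x1 y2 x3 := unital_add12 ord hk1 bas.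
have [k2 [hk2 s2]] := size_reduce (M x1 y2 x3) (proj_gram_gt0 bas1).
pose y3 := x3 + k2 *: y2; have bas2 : unital_basis O x1 y2 y3 := unital_add23 ord hk2 bas1.
have [k3 [hk3 s3]] := size_reduce (G x1 y3) n1.
pose z3 := y3 + k3 *: x1; have bas3 : unital_basis O x1 y2 z3 := unital_add13 ord hk3 bas2.
have eT : T x1 y2 z3 ^+ 2 = T x1 x2 x3 ^+ 2.
  by rewrite /z3 /y3 /y2 triple_shift13 triple_shift23 triple_shift12.
have eM : M x1 y2 y2 = M x1 x2 x2.
  by rewrite proj_gramSl proj_gramSr.
have {}s1 : `|2 * G x1 y2| <= G x1 x1 by rewrite /y2 gramGDr gramGZr.
have {}s3 : `|2 * G x1 z3| <= G x1 x1 by rewrite /z3 gramGDr gramGZr.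
have {}s2 : `|2 * M x1 y2 z3| <= M x1 y2 y2.
  by rewrite proj_gramSr proj_gramDr proj_gramZr.
have [h1 h2 h3] : [/\ O x1, O y2 & O z3] by case: bas3 => _ [].
have [hM2 hM3] : Zint (M x1 y2 y2) /\ Zint (M x1 z3 z3).
  have := gramG_int h1 h1; have := gramG_int h1 h2; have := gramG_int h1 h3.
  have := gramG_int h2 h2; have := gramG_int h3 h3; rewrite !proj_gramE => *; split; zint.
case: (lerP (G x1 x1) (G y2 y2)) => [le12|lt21].
  case: (lerP (M x1 y2 y2) (M x1 z3 z3)) => [le23|lt32].
    by exists x1, y2, z3.
  have [|y1' [y2' [y3' [? ? e]]]] := IHm x1 z3 y2 (unital_swap23 bas3) hn.
    by rewrite -(lerD2r 1) natr1 (le_trans (Zint_ltS hM3 hM2 lt32)) // eM.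
  exists y1', y2', y3'.
  by split=> //; rewrite e -eT triple_swap23 sqrrN.
have [m' hm'] := nat_bound (M y2 x1 x1).
have [|y1' [y2' [y3' [? ? e]]]] := IHn m' y2 x1 z3 (unital_swap12 bas3) _ hm'.
  by rewrite -(lerD2r 1) natr1 (le_trans (Zint_ltS _ _ lt21)) ?gramG_int.
exists y1', y2', y3'.
  by split=> //; rewrite e -eT triple_swap12 sqrrN.
Qed.

(** Lagrange's bound is applied twice: [3 A^2 <= 4 u] in the plane of [x1, x2], and
    [3 u^2 <= 16 A t] for the projected form, where [A = G x1 x1], [u = M x1 x2 x2] and [t] is the
    square of [triple]. *)
Lemma hermite_bound x1 x2 x3 : unital_basis O x1 x2 x3 -> reduced x1 x2 x3 ->
  27 * G x1 x1 ^+ 3 <= 256 * T x1 x2 x3 ^+ 2.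
Proof.
move=> bas [h12 h23 hb hs _]; have [/gramG_gt0 A0 _ _] := unital_pure_neq0 bas.
have := proj_gram_det a b x1 x2 x3; have eA : M x1 x2 x2 = G x1 x1 * G x2 x2 - G x1 x2 ^+ 2.
  by rewrite expr2 proj_gramE.
have a0 := proj_gram_gt0 bas.
move: (M x1 x2 x2) (M x1 x3 x3) (M x1 x2 x3) (T x1 x2 x3 ^+ 2) eA h23 hb a0.
move: (G x1 x1) (G x2 x2) (G x1 x2) A0 h12 hs => A D s A0 h12 hs u c v t eu h23 hb u0 e.
have {}hb := ler_half_sqr hb; have {}hs := ler_half_sqr hs.
have h1 : 3 * A ^+ 2 <= 4 * u.
  rewrite eu; have := ler_wpM2l (ltW A0) h12; rewrite -expr2; lra.
have h2 : 3 * u ^+ 2 <= 16 * (A * t).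
  have := ler_wpM2l (ltW u0) h23; rewrite -expr2; lra.
have h3 : 9 * A ^+ 4 <= 16 * u ^+ 2.
  have -> : 9 * A ^+ 4 = (3 * A ^+ 2) ^+ 2 by ring.
  have -> : 16 * u ^+ 2 = (4 * u) ^+ 2 by ring.
  by rewrite ler_sqr ?nnegrE //; rewrite pmulr_rge0 // ?sqr_ge0 // ltW.
rewrite -(ler_pM2l A0).
have -> : A * (27 * A ^+ 3) = 3 * (9 * A ^+ 4) by ring.
have -> : A * (256 * t) = 16 * (16 * (A * t)) by ring.
lra.
Qed.

End Reduction.

(** * The discriminant and the non-orthogonality *)

Lemma sqr_absz (n : int) : `|n|%N%:Z ^+ 2 = n ^+ 2.
Proof. by rewrite abszE real_normK ?num_real. Qed.

Section Bp.
Variables (p : nat) (hp : prime p) (a b : int) (O : quat -> Prop).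
Hypotheses (hB : is_Bp p a b) (maxO : maximal_order a b O).
Let ord : Defs.order a b O. Proof. by case: maxO. Qed.
Let pos : ramified_inf a b. Proof. by case: hB => _ [_ []]. Qed.
Local Notation G := (gramG a b).
Local Notation M := (proj_gram a b).
Local Notation T := (triple a b).
Local Notation N := (qnrd a b).
Local Notation cm := (commutator a b).

Lemma triple_int x1 x2 x3 : O x1 -> O x2 -> O x3 -> Zint (T x1 x2 x3).
Proof.
by move=> h1 h2 h3; apply: (order_trd_mul ord) => //; apply: (orderB ord); apply: orderM.
Qed.

(** Gathers the consequences of a radical vector [j]; here [l = p] because [nrd_sqr_in_mult] and
    [not_split_at] make the algebra ramified at [l]. *)
Lemma prime_dvd_triple l x1 x2 x3 : prime l -> unital_basis O x1 x2 x3 ->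
  divQ l (T x1 x2 x3) -> [/\ l = p, ~~ divQ (l ^ 2) (T x1 x2 x3) &
    forall x y z, O x -> O y -> O z ->
      divQ l (N (cm x y)) /\ divQ l (qtrd (qmul a b (cm x y) (qconj z)))].
Proof.
move=> hl bas /(exists_radical ord bas hl)[j [hj jl jN jtr]].
split; last 1 first.
- move=> x y z hx hy hz; have hN := nrd_commutator maxO hl hj jl jN jtr hx hy.
  split=> //; apply: (trd_mul_of_nrd maxO hl hj jl jN jtr) => //.
  by apply: (orderB ord); apply: orderM.
- have [_ [_ [_ /(_ l hl) [+ _]]]] := hB; apply.
  by apply: (not_split_at ord hl) => x; apply: (nrd_sqr_in_mult maxO hl hj jl jN jtr).
- exact: (triple_not_div_sqr maxO hl hj jl jN jtr bas).
Qed.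

Lemma triple_sqr x1 x2 x3 : unital_basis O x1 x2 x3 -> T x1 x2 x3 ^+ 2 = p%:R ^+ 2.
Proof.
move=> /(exists_reduced ord pos)[y1 [y2 [y3 [bas red <-]]]].
have [h1 h2 h3] : [/\ O y1, O y2 & O y3] by case: bas => _ [].
have [n0 _ _] := unital_pure_neq0 ord bas.
have := hermite_bound ord pos bas red; have := gramG_ge3 ord pos h1 n0.
move: (G y1 y1) => A A3 bound.
(* [27 A^3 <= 256 T^2] with [A >= 3] gives [T^2 > 2], so [T] has a prime divisor. *)
have {A A3}bound : 2 < T y1 y2 y3 ^+ 2.
  have : 27 <= A ^+ 3.
    have -> : 27 = 3 ^+ 3 :> rat by [].
    by rewrite lerXn2r ?nnegrE //; lra.
  by move: bound; move: (T _ _ _ ^+ 2) (A ^+ 3) => t c; lra.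
have div l : prime l -> divQ l (T y1 y2 y3) -> l = p /\ ~~ divQ (l ^ 2) (T y1 y2 y3).
  by move=> hl /(prime_dvd_triple hl bas)[].
have /intrP[n en] := triple_int h1 h2 h3; rewrite en in bound div *.
have {}div (l : nat) : prime l -> (l %| `|n|)%N -> l = p /\ ~~ (l ^ 2 %| `|n|)%N.
  by move=> hl; have := div l hl; rewrite !divQ_int ?expn_gt0 ?prime_gt0.
have n1 : (1 < `|n|)%N.
  have {}bound : 2 < n ^+ 2 by rewrite -rmorphXn -[2]/(2%:~R) ltr_int in bound.
  by rewrite ltnNge; apply/negP => le; move: bound; rewrite -sqr_absz; nia.
have [pe pn2] := div _ (pdiv_prime n1) (pdiv_dvd _).
have /dvdnP[m em] := pdiv_dvd `|n|; rewrite pe in em pn2.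
have m1 : m = 1%N.
  apply/eqP/negPn/negP => m1; have {}m1 : (1 < m)%N.
    by move: n1 m1; rewrite em; case: (m) => [|[|?]].
  have [|e _] := div _ (pdiv_prime m1).
    by rewrite em dvdn_mulr // pdiv_dvd.
  by case/negP: pn2; rewrite em expnS expn1 dvdn_mul // -e pdiv_dvd.
by rewrite -rmorphXn -sqr_absz em m1 mul1n rmorphXn /= -pmulrn.
Qed.

Lemma divQ_p_triple x1 x2 x3 : unital_basis O x1 x2 x3 -> divQ p (T x1 x2 x3).
Proof.
move=> bas; have [h1 h2 h3] : [/\ O x1, O x2 & O x3] by case: bas => _ [].
apply: (divQ_prime_sqr hp (triple_int h1 h2 h3)).
by rewrite (triple_sqr bas) expr2 divQ_self ?prime_gt0 ?Zint_nat.
Qed.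

(** By Lagrange's identity the minors are [4 N [x, y]] and [2 tr ([x, y] conj [x, z])], and [p]
    divides these norms and traces. *)
Lemma gramG_minor_dvd x1 x2 x3 : unital_basis O x1 x2 x3 ->
  forall x y z, O x -> O y -> O z -> exists m n : int,
    M x y y = (4 * p%:Z * m)%:~R /\ M x y z = (2 * p%:Z * n)%:~R.
Proof.
move=> bas x y z hx hy hz.
have [_ _ H] := prime_dvd_triple hp bas (divQ_p_triple bas).
have hc : O (cm x z) by apply: (orderB ord); apply: orderM.
have p0 : (p%:R : rat) != 0 by rewrite pnatr_eq0 -lt0n prime_gt0.
have [/intrP[m em] /intrP[n en]] := H x y (cm x z) hx hy hc.
exists m, n; rewrite !proj_gramE !gramG_minor qmul_conj qtrdZ qtrd1.
rewrite !rmorphM /= -pmulrn -em -en.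
by move: (N _) (qtrd _) => *; split; field.
Qed.

Lemma gramG_det_Bp x1 x2 x3 : unital_basis O x1 x2 x3 ->
  G x1 x1 * G x2 x2 * G x3 x3 + 2 * G x1 x2 * G x1 x3 * G x2 x3
  - G x1 x1 * G x2 x3 ^+ 2 - G x2 x2 * G x1 x3 ^+ 2 - G x3 x3 * G x1 x2 ^+ 2
  = (4 * p%:Z ^+ 2)%:~R.
Proof.
move=> bas; rewrite gramG_det (triple_sqr bas) rmorphM rmorphXn /= -pmulrn.
by [].
Qed.

(** For a diagonal Gram matrix the product of the three minors is the square of the determinant;
    with minors [4 p mi] this reads [p = 4 m1 m2 m3]. *)
Lemma gross_not_orthogonal : ~ orthogonal_lattice a b (gross_lattice O).
Proof.
case=> beta [/(unital_of_Zbasis ord)[x1 [x2 [x3 [bas eb]]]] orth].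
have [h1 h2 h3] : [/\ O x1, O x2 & O x3] by case: bas => _ [].
have o i j : i != j -> qinner a b (vec3 (pure x1) (pure x2) (pure x3) i)
    (vec3 (pure x1) (pure x2) (pure x3) j) = 0 by move=> /orth; rewrite !eb.
have G12 : G x1 x2 = 0 by rewrite gramG_qinner; apply: (o 0 1).
have G13 : G x1 x3 = 0 by rewrite gramG_qinner; apply: (o 0 2%:R).
have G23 : G x2 x3 = 0 by rewrite gramG_qinner; apply: (o 1 2%:R).
have := gramG_det_Bp bas.
have [m3 [_ [e3 _]]] := gramG_minor_dvd bas h1 h2 h2.
have [m2 [_ [e2 _]]] := gramG_minor_dvd bas h1 h3 h3.
have [m1 [_ [e1 _]]] := gramG_minor_dvd bas h2 h3 h3.
move: e1 e2 e3; rewrite !proj_gramE G12 G13 G23.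
have /intrP[d1 ->] := gramG_int ord h1 h1; have /intrP[d2 ->] := gramG_int ord h2 h2.
have /intrP[d3 ->] := gramG_int ord h3 h3.
rewrite !expr0n /= !(mulr0, mul0r, subr0, addr0) -!rmorphM => /intr_inj e1 /intr_inj e2 /intr_inj e3.
move/intr_inj => e.
have p0 : p%:Z != 0 by rewrite eqz_nat -lt0n prime_gt0.
have : (p%:Z = 4 * (m1 * m2 * m3))%R.
  apply: (mulfI (_ : 16 * p%:Z ^+ 3 != 0)); first by rewrite mulf_neq0 ?expf_neq0.
  transitivity ((4 * p%:Z ^+ 2) ^+ 2); first by ring.
  rewrite -e; transitivity (d2 * d3 * (d1 * d3) * (d1 * d2)); first by ring.
  by rewrite e1 e2 e3; ring.
move/(congr1 (fun z => (4 %| `|z|)%N)); rewrite abszM dvdn_mulr // => d4.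
have : (2 %| p)%N by apply: dvdn_trans d4.
by rewrite dvdn_prime2 // => /eqP p2; rewrite -p2 in d4.
Qed.

End Bp.

(** * Well-rounded lattices *)

Lemma int_parity (n : int) : exists m, n = 2 * m \/ n = 2 * m + 1.
Proof. by exists (n %/ 2)%Z; lia. Qed.

Lemma odd_intE (p : nat) : odd p -> exists c : int, p%:Z = 2 * c + 1.
Proof. by move=> op; exists (p./2)%:Z; rewrite -{1}(odd_double_half p) op; lia. Qed.

(** [D] is the diagonal entry and [r, s, t] are the off-diagonal entries after sign changes; the
    four inequalities come from the vectors [x1 +- x2 +- x3]. In terms of [X, Y, Z] they bound
    [p X Y Z] by 2. *)
Lemma well_rounded_core (p : nat) (D r s t : int) : odd p -> (2 < p)%N -> prime p ->
  ~~ (p%:Z %| D)%Z -> (p%:Z %| D - r)%Z -> (p%:Z %| D - s)%Z -> (p%:Z %| D * t - r * s)%Z ->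
  (4 * p%:Z %| D ^+ 2 - r ^+ 2)%Z -> (4 * p%:Z %| D ^+ 2 - s ^+ 2)%Z ->
  (4 * p%:Z %| D ^+ 2 - t ^+ 2)%Z ->
  D ^+ 3 + 2 * r * s * t - D * t ^+ 2 - D * s ^+ 2 - D * r ^+ 2 = 4 * p%:Z ^+ 2 ->
  0 <= D + r + s + t -> 0 <= D + r - s - t -> 0 <= D - r + s - t -> 0 <= D - r - s + t ->
  False.
Proof.
move=> odp p2 hp pD pr ps prs r4 s4 t4 det i0 i1 i2 i3.
have p0 : p%:Z != 0 by rewrite eqz_nat -lt0n prime_gt0.
have pt : (p%:Z %| D - t)%Z.
  have cop : coprimez p%:Z D by rewrite coprimezE /= prime_coprime // -dvdzE.
  rewrite -(Gauss_dvdzr _ cop).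
  have -> : D * (D - t) = D * (D - s) + s * (D - r) - (D * t - r * s) by ring.
  by rewrite rpredB // rpredD // dvdz_mull.
(* Write [D - q = u0 p]. Then [u0 (2 D - u0 p)] is divisible by 4, which fails for odd [u0]. *)
have half q : (p%:Z %| D - q)%Z -> (4 * p%:Z %| D ^+ 2 - q ^+ 2)%Z ->
    exists u, D - q = 2 * p%:Z * u.
  case/dvdzP=> u0 e /dvdzP[k]; have -> : D ^+ 2 - q ^+ 2 = (D - q) * (2 * D - (D - q)) by ring.
  rewrite e => h.
  have {}h : u0 * (2 * D - u0 * p%:Z) = 4 * k.
    by apply: (mulIf p0); rewrite -[RHS]mulrA [RHS]mulrC -[RHS]mulrA -mulrAC h; ring.
  have [c ec] := odd_intE odp; have [v [ev|ev]] := int_parity u0.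
    by exists v; rewrite ev; ring.
  exfalso; move: h; rewrite ev ec.
  have -> : (2 * v + 1) * (2 * D - (2 * v + 1) * (2 * c + 1)) =
     2 * ((2 * v + 1) * D - (4 * v * v + 4 * v + 1) * c - 2 * v * v - 2 * v) - 1 by ring.
  by move: (_ * D - _ - _ - _) => m; clear; lia.
have [u eu] := half _ pr r4; have [v ev] := half _ ps s4; have [w ew] := half _ pt t4.
have {}eu : r = D - 2 * p%:Z * u by rewrite -eu; ring.
have {}ev : s = D - 2 * p%:Z * v by rewrite -ev; ring.
have {}ew : t = D - 2 * p%:Z * w by rewrite -ew; ring.
rewrite eu ev ew in det i0 i1 i2 i3; clear - p2 p0 det i0 i1 i2 i3.
have P3 : 3 <= p%:Z by lia.
move: (p%:Z) P3 p0 det i0 i1 i2 i3 => P P3 p0 det i0 i1 i2 i3.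
have [X eX] : exists X, X = v + w - u by exists (v + w - u).
have [Y eY] : exists Y, Y = u + w - v by exists (u + w - v).
have [Z eZ] : exists Z, Z = u + v - w by exists (u + v - w).
have P0 : 0 < P by lia.
have X0 : 0 <= X.
  by rewrite -(pmulr_rge0 _ P0); move: i1; rewrite eX; lia.
have Y0 : 0 <= Y.
  by rewrite -(pmulr_rge0 _ P0); move: i2; rewrite eY; lia.
have Z0 : 0 <= Z.
  by rewrite -(pmulr_rge0 _ P0); move: i3; rewrite eZ; lia.
pose K := X * Y + Y * Z + Z * X.
have eK : 2 * D * K = 2 + P * ((X + Y) * (Y + Z) * (Z + X)).
  have P2 : 2 * P ^+ 2 != 0 by rewrite mulf_neq0 ?expf_neq0.
  apply: (mulfI P2).
  have -> : 2 * P ^+ 2 * (2 * D * K) =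
    (D ^+ 3 + 2 * (D - 2 * P * u) * (D - 2 * P * v) * (D - 2 * P * w)
     - D * (D - 2 * P * w) ^+ 2 - D * (D - 2 * P * v) ^+ 2 - D * (D - 2 * P * u) ^+ 2)
    + 2 * P ^+ 2 * (P * ((X + Y) * (Y + Z) * (Z + X))).
    by rewrite /K eX eY eZ; ring.
  by rewrite det; ring.
have sum : P * (X + Y + Z) <= 2 * D by move: i0; rewrite eX eY eZ; lia.
have K0 : 0 <= K by rewrite /K !addr_ge0 ?mulr_ge0.
(* [D K] is odd, hence so is [K]; as [X, Y, Z] have the same parity, all three are odd. *)
have oddX : (X * Y * Z != 0).
  have oK : exists c, K = 2 * c + 1.
    have h : D * K = 1 + 4 * P * (u * v * w).
      by apply: (@mulfI _ 2) => //; rewrite [LHS]mulrA eK eX eY eZ; ring.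
    have [c [ec|ec]] := int_parity K.
      by move: h; rewrite ec mulrCA -!mulrA; lia.
    by exists c.
  have [c ec] := oK.
  have [d [ed|ed]] := int_parity X.
    have eY' : Y = 2 * (d + u - v) by lia.
    have eZ' : Z = 2 * (d + u - w) by lia.
    move: ec; rewrite /K ed eY' eZ' -!mulrA -!mulrDr; lia.
  by rewrite !mulf_neq0 //; lia.
have le1 : P * (X + Y + Z) * K <= 2 * D * K by apply: ler_wpM2r.
have XYZ1 : 1 <= X * Y * Z.
  have : 0 <= X * Y * Z by rewrite !mulr_ge0.
  by move: (X * Y * Z) oddX => m; clear; lia.
(* [(X + Y + Z) K] exceeds [(X + Y) (Y + Z) (Z + X)] by exactly [X Y Z]. *)
have XYZ2 : P * (X * Y * Z) <= 2.
  have e : P * (X + Y + Z) * K = P * ((X + Y) * (Y + Z) * (Z + X)) + P * (X * Y * Z).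
    by rewrite /K; ring.
  by move: le1; rewrite eK e [leRHS]addrC lerD2l.
have := le_trans (ler_wpM2l (ltW P0) XYZ1) XYZ2; rewrite mulr1.
by move: P3; clear; lia.
Qed.

(** The three vectors and [pure x] all lie in the kernel of the scalar coordinate, which has
    dimension 3. *)
Lemma pure_span y1 y2 y3 : qc y1 0 = 0 -> qc y2 0 = 0 -> qc y3 0 = 0 ->
  row_free (vmx (vec3 y1 y2 y3)) -> forall x, exists c1 c2 c3,
  pure x = c1 *: y1 + c2 *: y2 + c3 *: y3.
Proof.
move=> e1 e2 e3 free x; set v := vmx _ in free.
pose e0 : 'M[rat]_(4, 1) := delta_mx 0 0.
have col0 (u : 'rV[rat]_4) : qc u 0 = 0 -> u *m e0 = 0.
  move=> hu; rewrite -colE; apply/rowP => i; rewrite !mxE -[RHS]hu /qc.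
  by congr (u _ _); apply: val_inj; rewrite /= ?inordK // (ord1 i).
have px : (pure x <= kermx e0)%MS.
  by apply/sub_kermxP/col0; rewrite /pure /qtrd /qconj /qone !qcE; ring.
have vx : (v <= kermx e0)%MS.
  apply/row_subP => i; apply/sub_kermxP/col0.
  have -> : row i v = vec3 y1 y2 y3 i by apply/rowP => k; rewrite !mxE.
  by case: i => [[|[|[|i]]] hi].
have rk : \rank (kermx e0) = 3%N by rewrite mxrank_ker mxrank_delta.
have kv : (kermx e0 <= v)%MS.
  by rewrite -(geq_leqif (mxrank_leqif_sup vx)) rk (eqP free).
have /submxP[D eD] := submx_trans px kv.
exists (D 0 0), (D 0 1), (D 0 2%:R).
rewrite eD mulmx_sum_row (eq_bigr (fun i => D 0 i *: vec3 y1 y2 y3 i)).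
  by rewrite (sum_vec3 (fun y i => D 0 i *: y)).
by move=> i _; congr (_ *: _); apply/rowP => k; rewrite !mxE.
Qed.

(** * Independent minimal vectors form a basis *)

Section WellRounded.
Variables (a b : int) (O : quat -> Prop).
Hypotheses (ord : Defs.order a b O) (pos : ramified_inf a b).
Local Notation G := (gramG a b).
Local Notation M := (proj_gram a b).
Variables x1 x2 x3 : quat.
Hypotheses (h1 : O x1) (h2 : O x2) (h3 : O x3).
Let S c1 c2 c3 := c1 *: x1 + c2 *: x2 + c3 *: x3.
Hypothesis ind : forall c1 c2 c3, pure (S c1 c2 c3) = 0 -> [/\ c1 = 0, c2 = 0 & c3 = 0].
Hypothesis span : forall x, exists c1 c2 c3, pure x = pure (S c1 c2 c3).
Variable D : rat.
Hypotheses (G1 : G x1 x1 = D) (G2 : G x2 x2 = D) (G3 : G x3 x3 = D).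
Hypothesis min : forall x, O x -> pure x != 0 -> D <= G x x.

Lemma pure_eq_gramG x y : pure x = pure y -> G x x = G y y.
Proof. by rewrite !gramG_qinner => ->. Qed.

Lemma gramG_S c1 c2 c3 : G (S c1 c2 c3) (S c1 c2 c3) =
  D * (c1 ^+ 2 + c2 ^+ 2 + c3 ^+ 2)
  + 2 * (c1 * c2 * G x1 x2 + c1 * c3 * G x1 x3 + c2 * c3 * G x2 x3).
Proof.
rewrite /S !gramGDr !gramGZr !gramGDl !gramGZl G1 G2 G3 (gramGC _ _ x2 x1).
by rewrite (gramGC _ _ x3 x1) (gramGC _ _ x3 x2); abstract_gram; ring.
Qed.

Lemma O_S c1 c2 c3 : Zint c1 -> Zint c2 -> Zint c3 -> O (S c1 c2 c3).
Proof. by move=> ? ? ?; do ?apply: (orderD ord); apply: (orderZ ord). Qed.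

Lemma min_S c1 c2 c3 : Zint c1 -> Zint c2 -> Zint c3 -> [|| c1 != 0, c2 != 0 | c3 != 0] ->
  D <= D * (c1 ^+ 2 + c2 ^+ 2 + c3 ^+ 2)
  + 2 * (c1 * c2 * G x1 x2 + c1 * c3 * G x1 x3 + c2 * c3 * G x2 x3).
Proof.
move=> i1 i2 i3 nz; rewrite -gramG_S; apply: min; first exact: O_S.
by apply/eqP => /ind[e1 e2 e3]; move: nz; rewrite e1 e2 e3 eqxx.
Qed.

Lemma min_gt0 : 0 < D.
Proof.
rewrite -G1 gramG_gt0 //; apply/eqP => e; have [|/eqP] := ind (c1 := 1) (c2 := 0) (c3 := 0).
  by rewrite /S scale1r !scale0r !addr0.
by rewrite oner_eq0.
Qed.

Let Zint0 : Zint 0. Proof. exact: rpred0. Qed.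

(** From the norms of [xi + xj] and [xi - xj], which are at least [D]. *)
Lemma min_pairs : [/\ `|2 * G x1 x2| <= D, `|2 * G x1 x3| <= D & `|2 * G x2 x3| <= D].
Proof.
have ZN1 : Zint (-1) by zint.
have Z1 := Zint1.
have := min_S Z1 Z1 Zint0 isT; have := min_S Z1 ZN1 Zint0 isT.
have := min_S Z1 Zint0 Z1 isT; have := min_S Z1 Zint0 ZN1 isT.
have := min_S Zint0 Z1 Z1 isT; have := min_S Zint0 Z1 ZN1 isT.
by abstract_gram => *; split; rewrite ler_norml; apply/andP; split; lra.
Qed.

(* Rounding the coordinates successively, from the last to the first, moves a
   lattice vector to one of norm at most [3 D / 4], which must vanish. *)
Lemma minimal_vectors_basis : unital_basis O x1 x2 x3.
Proof.
have aux1 (q g d : rat) : 0 <= g -> 4 * q <= d - g + d -> 2 * q <= d by lra.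
have aux2 (q r d : rat) : 0 < d -> 4 * r <= d -> 2 * q <= d -> r + q < d by lra.
apply: (unital_basis_of ord) => //.
  by move=> c1 c2 c3; rewrite -!pureZ -!pureD => /ind.
move=> x hx; have [c1 [c2 [c3 ex]]] := span x.
suff [i1 i2 i3] : [/\ Zint c1, Zint c2 & Zint c3].
  by exists c1, c2, c3; split=> //; rewrite ex /S !pureD !pureZ.
have D0 := min_gt0; have [p12 p13 p23] := min_pairs.
have M2 : M x1 x2 x2 = D ^+ 2 - G x1 x2 ^+ 2 by rewrite proj_gramE G1 G2 !expr2.
have M3 : M x1 x3 x3 = D ^+ 2 - G x1 x3 ^+ 2 by rewrite proj_gramE G1 G3 !expr2.
have s12 := ler_half_sqr p12; have s13 := ler_half_sqr p13.
have D2 : 0 < D ^+ 2 by rewrite exprn_gt0.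
have u0 : 0 < M x1 x2 x2.
  rewrite M2 subr_gt0 (@le_lt_trans _ _ (4 * G x1 x2 ^+ 2 / 4)) //; first by rewrite mulrC mulKf.
  by rewrite ltr_pdivrMr // (le_lt_trans s12) // ltr_pMr.
have [k3 [i3 r3]] := size_reduce c3 (@ltr01 rat); rewrite mulr1 in r3.
have [k2 [i2 r2]] := size_reduce (M x1 x2 x2 * c2 + M x1 x2 x3 * (c3 + k3)) u0.
have [k1 [i1 r1]] := size_reduce (D * c1 + G x1 x2 * (c2 + k2) + G x1 x3 * (c3 + k3)) D0.
have e0 : pure (S (c1 + k1) (c2 + k2) (c3 + k3)) = 0.
  apply/eqP/negPn/negP => nz.
  have ey : pure (S (c1 + k1) (c2 + k2) (c3 + k3)) = pure (x + S k1 k2 k3).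
    by rewrite pureD ex -pureD /S; congr pure; apply/rowP => i; rewrite !mxE; ring.
  have : D <= G (S (c1 + k1) (c2 + k2) (c3 + k3)) (S (c1 + k1) (c2 + k2) (c3 + k3)).
    rewrite (pure_eq_gramG ey) min ?(ey : _ = _) -?ey //.
    by apply: (orderD ord) => //; apply: O_S.
  apply/negP; rewrite -ltNge gramG_S.
  have {}r1 : `|2 * (D * (c1 + k1) + G x1 x2 * (c2 + k2) + G x1 x3 * (c3 + k3))| <= D.
    by move: r1; congr (is_true (`|2 * _| <= _)); ring.
  have {}r2 : `|2 * (M x1 x2 x2 * (c2 + k2) + M x1 x2 x3 * (c3 + k3))| <= M x1 x2 x2.
    by move: r2; congr (is_true (`|2 * _| <= _)); ring.
  move: (c1 + k1) (c2 + k2) (c3 + k3) r1 r2 r3 => d1 d2 d3.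
  move=> /ler_half_sqr r1 /ler_half_sqr r2 /ler_half_sqr r3.
  (* Completing the square twice: [D] times the norm is a square of size at most [D^2 / 4] plus [q],
     and [q <= D^2 / 2] because [M x1 x2 x2 <= D^2]. *)
  have eu : M x1 x2 x2 * (M x1 x2 x2 * d2 ^+ 2 + 2 * M x1 x2 x3 * d2 * d3 + M x1 x3 x3 * d3 ^+ 2)
     = (M x1 x2 x2 * d2 + M x1 x2 x3 * d3) ^+ 2
       + (M x1 x2 x2 * M x1 x3 x3 - M x1 x2 x3 ^+ 2) * d3 ^+ 2.
    by move: (M x1 x2 x2) (M x1 x2 x3) (M x1 x3 x3) => *; ring.
  set q := M x1 x2 x2 * d2 ^+ 2 + _ + _ in eu.
  have eD : D * (D * (d1 ^+ 2 + d2 ^+ 2 + d3 ^+ 2)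
    + 2 * (d1 * d2 * G x1 x2 + d1 * d3 * G x1 x3 + d2 * d3 * G x2 x3))
     = (D * d1 + G x1 x2 * d2 + G x1 x3 * d3) ^+ 2 + q.
    by rewrite /q M2 M3 proj_gramE G1; abstract_gram; ring.
  have qD : 2 * q <= D ^+ 2.
    have d3le : (M x1 x2 x2 * M x1 x3 x3 - M x1 x2 x3 ^+ 2) * d3 ^+ 2
        <= M x1 x2 x2 * D ^+ 2 / 4.
      have d30 : 0 <= d3 ^+ 2 by rewrite sqr_ge0.
      apply: (@le_trans _ _ (M x1 x2 x2 * D ^+ 2 * d3 ^+ 2)).
        apply: ler_wpM2r => //; apply: (@le_trans _ _ (M x1 x2 x2 * M x1 x3 x3)).
          by rewrite lerBlDr lerDl sqr_ge0.
        by rewrite ler_pM2l // M3 lerBlDr lerDl sqr_ge0.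
      apply: ler_wpM2l; first by rewrite mulr_ge0 // ltW.
      by move: r3; rewrite expr1n -ler_pdivlMl // mulr1.
    have le2 : 4 * (M x1 x2 x2 * q) <= M x1 x2 x2 * (M x1 x2 x2 + D ^+ 2).
      have -> : M x1 x2 x2 * (M x1 x2 x2 + D ^+ 2) = M x1 x2 x2 ^+ 2 + M x1 x2 x2 * D ^+ 2.
        by rewrite mulrDr -expr2.
      rewrite eu [leLHS]mulrDr.
      by rewrite lerD // mulrC -ler_pdivlMr.
    move: le2; rewrite mulrCA ler_pM2l // M2; apply: aux1; exact: sqr_ge0.
  by rewrite -(ltr_pM2l D0) eD -[X in _ < X]expr2 aux2.
have [e1 e2 e3] := ind e0.
have zi c k : Zint k -> c + k = 0 -> Zint c.
  by move=> hk /eqP; rewrite addr_eq0 => /eqP ->; zint.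
by split; [apply: zi i1 e1 | apply: zi i2 e2 | apply: zi i3 e3].
Qed.

End WellRounded.

(** Each off-diagonal entry is plus or minus [D] modulo [p]; changing signs of basis vectors reduces
    to [well_rounded_core]. *)
Lemma gross_not_well_rounded (p : nat) (a b : int) (O : quat -> Prop) :
  prime p -> (3 <= p)%N -> is_Bp p a b -> maximal_order a b O ->
  ~ well_rounded3 a b (gross_lattice O).
Proof.
move=> hp p3 hB maxO [v [Lv [free minv]]].
have ord : Defs.order a b O by case: maxO.
have pos : ramified_inf a b by case: hB => _ [_ []].
have [x1 [h1 e1]] := Lv 0; have [x2 [h2 e2]] := Lv 1; have [x3 [h3 e3]] := Lv 2%:R.
have ev : v =1 vec3 (pure x1) (pure x2) (pure x3).
  by move=> i; rewrite [LHS]vec3_eta e1 e2 e3.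
rewrite (vmx_ext ev) in free.
have ind : forall c1 c2 c3 : rat, pure (c1 *: x1 + c2 *: x2 + c3 *: x3) = 0 ->
    [/\ c1 = 0, c2 = 0 & c3 = 0].
  by move=> c1 c2 c3; rewrite !pureD !pureZ; apply: (proj1 (row_free_vec3 _ _ _) free).
have qc_pure x : qc (pure x) 0 = 0.
  by rewrite /pure /qtrd /qconj /qone !qcE; ring.
have span x : exists c1 c2 c3, pure x = pure (c1 *: x1 + c2 *: x2 + c3 *: x3).
  have [c1 [c2 [c3 e]]] := pure_span (qc_pure x1) (qc_pure x2) (qc_pure x3) free x.
  by exists c1, c2, c3; rewrite !pureD !pureZ.
have nz x c1 c2 c3 : x = c1 *: x1 + c2 *: x2 + c3 *: x3 ->
    [|| c1 != 0, c2 != 0 | c3 != 0] -> pure x != 0.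
  by move=> -> h; apply/eqP => /ind[z1 z2 z3]; move: h; rewrite z1 z2 z3 eqxx.
have n1 : pure x1 != 0 by apply: (nz x1 1 0 0); rewrite ?scale1r ?scale0r ?addr0.
have n2 : pure x2 != 0 by apply: (nz x2 0 1 0); rewrite ?scale1r ?scale0r ?addr0 ?add0r.
have n3 : pure x3 != 0 by apply: (nz x3 0 0 1); rewrite ?scale1r ?scale0r ?addr0 ?add0r.
have minG (i : 'I_3) y x : O x -> pure x != 0 -> v i = pure y ->
    gramG a b y y <= gramG a b x x.
  by move=> hx nx e; rewrite !gramG_qinner !qinner_nrd -e; apply: minv => //; exists x.
have [D eD] : exists D, gramG a b x1 x1 = D by exists (gramG a b x1 x1).
have G2 : gramG a b x2 x2 = D.
  by apply/le_anti; rewrite -eD (minG 1 x2 x1) ?(minG 0 x1 x2).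
have G3 : gramG a b x3 x3 = D.
  by apply/le_anti; rewrite -eD (minG 2%:R x3 x1) ?(minG 0 x1 x3).
have min x : O x -> pure x != 0 -> D <= gramG a b x x.
  by move=> hx nx; rewrite -eD; apply: (minG 0).
have bas := minimal_vectors_basis ord pos h1 h2 h3 ind span eD G2 G3 min.
have Z1 := Zint1; have ZN1 : Zint (-1) by zint.
(* The vectors [x1 +- x2 +- x3] have norm at least [D]. *)
have q0 := min_S ord h1 h2 h3 ind eD G2 G3 min Z1 Z1 Z1 isT.
have q1 := min_S ord h1 h2 h3 ind eD G2 G3 min Z1 Z1 ZN1 isT.
have q2 := min_S ord h1 h2 h3 ind eD G2 G3 min Z1 ZN1 Z1 isT.
have q3 := min_S ord h1 h2 h3 ind eD G2 G3 min Z1 ZN1 ZN1 isT.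
have := gramG_det_Bp hp hB maxO bas.
have [m3 [_ [f3 _]]] := gramG_minor_dvd hp hB maxO bas h1 h2 h2.
have [m2 [_ [f2 _]]] := gramG_minor_dvd hp hB maxO bas h1 h3 h3.
have [m1 [_ [f1 _]]] := gramG_minor_dvd hp hB maxO bas h2 h3 h3.
have [_ [n [_ f4]]] := gramG_minor_dvd hp hB maxO bas h1 h2 h3.
move: f1 f2 f3 f4 q0 q1 q2 q3; rewrite !proj_gramE eD G2 G3; clear -hp p3 eD h1 h2 h3 ord.
have /intrP[d ed] := gramG_int ord h1 h1; rewrite -{}eD {D}ed.
have /intrP[r ->] := gramG_int ord h1 h2; have /intrP[s ->] := gramG_int ord h1 h3.
have /intrP[t ->] := gramG_int ord h2 h3; clear -hp p3.
rewrite -!rmorphM -!rmorphB => /intr_inj f1 /intr_inj f2 /intr_inj f3 /intr_inj f4.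
rewrite !(mulr1, mul1r, mulrN1, mulNr, mulrNN, expr1n, sqrrN).
have toint (i j k : int) : d%:~R <= d%:~R * (1 + 1 + 1) + 2 * (i%:~R + j%:~R + k%:~R) :> rat ->
    0 <= d + i + j + k.
  by rewrite -(ler_int rat) !rmorphD /=; lra.
rewrite -!rmorphN /= => /toint q0 /toint q1 /toint q2 /toint q3.
rewrite -[2]/(2%:~R) -!rmorphXn -!rmorphM -rmorphD -!rmorphB /= => /intr_inj det.
have p2 : (2 < p)%N by [].
have odp : odd p by have [e|//] := even_prime hp; rewrite e in p2.
have pcop z : (p%:Z %| z ^+ 2)%Z -> (p%:Z %| z)%Z.
  by rewrite !dvdzE abszX Euclid_dvdX // => /andP[].
have r4 : (4 * p%:Z %| d ^+ 2 - r ^+ 2)%Z by rewrite !expr2 f3 dvdz_mulr.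
have s4 : (4 * p%:Z %| d ^+ 2 - s ^+ 2)%Z by rewrite !expr2 f2 dvdz_mulr.
have t4 : (4 * p%:Z %| d ^+ 2 - t ^+ 2)%Z by rewrite !expr2 f1 dvdz_mulr.
have prs : (p%:Z %| d * t - r * s)%Z by rewrite f4 mulrAC dvdz_mull.
have pdvd q : (4 * p%:Z %| d ^+ 2 - q ^+ 2)%Z -> (p%:Z %| d ^+ 2 - q ^+ 2)%Z.
  by apply: dvdz_trans; rewrite dvdz_mull.
(* If [p | D], then [p] divides all entries and [p^3] divides the determinant [4 p^2]. *)
have pd : ~~ (p%:Z %| d)%Z.
  apply/negP => hd.
  have root q : (4 * p%:Z %| d ^+ 2 - q ^+ 2)%Z -> (p%:Z %| q)%Z.
    move/pdvd => h; apply: pcop; have -> : q ^+ 2 = d * d - (d ^+ 2 - q ^+ 2) by ring.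
    by rewrite rpredB // dvdz_mull.
  have /dvdzP[d' ed] := hd; have /dvdzP[r' er] := root _ r4.
  have /dvdzP[s' es] := root _ s4; have /dvdzP[t' et] := root _ t4.
  have p0 : p%:Z ^+ 2 != 0 by rewrite expf_neq0 // eqz_nat -lt0n prime_gt0.
  have : 4 = p%:Z * (d' ^+ 3 + 2 * r' * s' * t' - d' * t' ^+ 2 - d' * s' ^+ 2 - d' * r' ^+ 2).
    apply: (mulIf p0); rewrite -det ed er es et; ring.
  move/(congr1 (fun z => (p %| `|z|)%N)); rewrite abszM dvdn_mulr //.
  move=> d4; have {d4} : (p %| 2 ^ 2)%N by rewrite /= d4.
  by rewrite Euclid_dvdX // andbT dvdn_prime2 // => /eqP pe; rewrite pe in p2.
have split q : (4 * p%:Z %| d ^+ 2 - q ^+ 2)%Z -> (p%:Z %| d - q)%Z \/ (p%:Z %| d + q)%Z.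
  move/pdvd; rewrite subr_sqr !dvdzE abszM Euclid_dvdM // => /orP[]; by [left|right].
have core := @well_rounded_core p d _ _ _ odp p2 hp pd.
have prsN : (p%:Z %| - (d * t - r * s))%Z by rewrite rpredN.
(* Negating one basis vector flips two of the three entries and permutes the four inequalities. *)
have [pr|pr] := split _ r4; have [ps|ps] := split _ s4.
- by apply: (core r s t) => //; rewrite -det; ring.
- apply: (core r (- s) (- t)); rewrite ?sqrrN ?opprK //; last by rewrite -det; ring.
  by rewrite (_ : d * - t - r * - s = - (d * t - r * s)) //; ring.
- apply: (core (- r) s (- t)); rewrite ?sqrrN ?opprK //; last by rewrite -det; ring.
  by rewrite (_ : d * - t - - r * s = - (d * t - r * s)) //; ring.
- by apply: (core (- r) (- s) t); rewrite ?sqrrN ?opprK ?mulrNN //; rewrite -det; ring.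
Qed.

(** * The case p = 2 *)

Lemma row_free_sub m n (f : 'I_m -> 'I_n) (v : 'I_n -> quat) : injective f ->
  row_free (vmx v) -> row_free (vmx (v \o f)).
Proof.
move=> inj /row_free_vmxP free; apply/row_free_vmxP => c hc i.
pose c' k := \sum_(j | f j == k) c j.
have -> : c i = c' (f i).
  by rewrite /c' (bigD1 i) //= big1 ?addr0 // => j /andP[/eqP/inj ->]; rewrite eqxx.
apply: free; rewrite -[RHS]hc (partition_big f xpredT) //=.
apply: eq_bigr => k _; rewrite scaler_suml.
by apply: eq_bigr => j /eqP <-.
Qed.

Section Two.
Variables (a b : int) (O : quat -> Prop).
Hypotheses (hB : is_Bp 2 a b) (maxO : maximal_order a b O).
Let ord : Defs.order a b O. Proof. by case: maxO. Qed.
Let pos : ramified_inf a b. Proof. by case: hB => _ [_ []]. Qed.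
Let hp : prime 2 := isT.
Local Notation G := (gramG a b).
Local Notation M := (proj_gram a b).
Local Notation L := (gross_lattice O).

Lemma gross2_norm x3 : G x3 x3 = 3 -> qnrd a b (pure x3) = 3.
Proof. by rewrite gramG_qinner qinner_nrd. Qed.

Lemma gross2_min y : L y -> y != 0 -> 3 <= qnrd a b y.
Proof.
by case=> x [hx ->] nz; rewrite -qinner_nrd -gramG_qinner; apply: (gramG_ge3 ord pos hx).
Qed.

(* In a reduced basis the projected binary lattice, divided by 8, is
   integral of discriminant -3, hence is the hexagonal lattice. *)
Lemma gross2_basis : exists x1 x2 x3, [/\ unital_basis O x1 x2 x3,
  G x1 x1 = 3, G x2 x2 = 3 & G x3 x3 = 3].
Proof.
have [w1 [w2 [w3 bas0]]] := exists_unital_basis ord.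
have [x1 [x2 [x3 [bas red _]]]] := exists_reduced ord pos bas0.
have [h1 h2 h3] : [/\ O x1, O x2 & O x3] by case: bas => _ [].
have [n1 _ _] := unital_pure_neq0 ord bas.
have G1 : G x1 x1 = 3.
  have := hermite_bound ord pos bas red; rewrite (triple_sqr hp hB maxO bas).
  have := gramG_ge3 ord pos h1 n1; have /intrP[n ->] := gramG_int ord h1 h1.
  rewrite -[3]/(3%:~R) ler_int => n3 bound.
  have {}bound : 27 * n ^+ 3 <= 1024.
    by rewrite -(ler_int rat) rmorphM rmorphXn; move: bound; congr (is_true (_ <= _)).
  congr _%:~R; apply/le_anti; rewrite n3 andbT leNgt; apply/negP => n4.
  have : 4 ^+ 3 <= n ^+ 3 by rewrite lerXn2r ?nnegrE //; lia.
  by move: bound; move: (n ^+ 3) => m; lia.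
exists x1, x2, x3; suff [-> ->] : G x2 x2 = 3 /\ G x3 x3 = 3 by [].
have [_ h23 hb hs ht] := red.
have u0 := proj_gram_gt0 ord pos bas.
have := proj_gram_det a b x1 x2 x3; rewrite (triple_sqr hp hB maxO bas) G1.
have [m [n [em en]]] := gramG_minor_dvd hp hB maxO bas h1 h2 h3.
have [k [_ [ek _]]] := gramG_minor_dvd hp hB maxO bas h1 h3 h3.
move: h23 hb u0 hs ht; rewrite en em ek -[2]/(2%:~R) -!rmorphM -!intr_norm !ler_int ltr0z => h23 hb u0 hs ht det.
have {}det : (8 * m) * (8 * k) - (4 * n) ^+ 2 = 48.
  by apply: (@intr_inj rat); rewrite -[RHS]det !(rmorphM, rmorphB, rmorphXn) /=.
(* The determinant reads [4 m k - n^2 = 3] with [|n| <= m <= k], so [3 m^2 <= 3]. *)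
have [m1 k1] : m = 1 /\ k = 1 by move: det h23 hb u0; nia.
move: em ek; rewrite !proj_gramE G1 m1 k1.
move: hs ht; rewrite G1; have /intrP[s ->] := gramG_int ord h1 h2.
have /intrP[t ->] := gramG_int ord h1 h3; have /intrP[d2 ->] := gramG_int ord h2 h2.
have /intrP[d3 ->] := gramG_int ord h3 h3.
rewrite -[3]/(3%:~R) -!rmorphM -!rmorphB -!intr_norm !ler_int => hs ht /intr_inj e2 /intr_inj e3.
(* Here [z] is 0, 1 or -1, and [z = 0] would make 3 divide 8. *)
have small (z d : int) : `|2 * z| <= 3 -> 3 * d - z * z = 4 * 2 * 1 -> d = 3.
  move=> hz; have : z = 0 \/ z = 1 \/ z = -1 by lia.
  by case=> [->|[->|->]]; lia.
by rewrite (small s d2) // (small t d3).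
Qed.

Lemma gross2_span_rank x1 x2 x3 (n : nat) D : unital_basis O x1 x2 x3 ->
  G x1 x1 = 3 -> G x2 x2 = 3 -> G x3 x3 = 3 -> (n <= 3)%N -> 3 <= D ->
  span_rank_ge (fun x => L x /\ qnrd a b x <= D) n.
Proof.
move=> bas G1 G2 G3 n3 hD; have [h1 h2 h3] : [/\ O x1, O x2 & O x3] by case: bas => _ [].
exists (vec3 (pure x1) (pure x2) (pure x3) \o widen_ord n3); split.
  move=> i; rewrite /=; move: (widen_ord n3 i) => {i}[[|[|[|i]]] hi] //; rewrite /vec3 /=;
    split; try exact: gross_pure; by rewrite gross2_norm.
apply: row_free_sub; last by have [] := Zbasis_of_unital ord bas.
by move=> i j /(congr1 val) /= /val_inj.
Qed.

Lemma gross2_span_rank_lt (n : nat) D : D < 3 ->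
  ~ span_rank_ge (fun x => L x /\ qnrd a b x <= D) n.+1.
Proof.
move=> hD [v [hv /row_free_vmxP free]]; have [Lv Nv] := hv ord0.
have /(gross2_min Lv) : v ord0 != 0.
  apply/eqP => e; have := free (fun i => (i == ord0)%:R).
  rewrite big_ord_recl e scaler0 add0r big1 => [/(_ erefl ord0)/eqP|i _].
    by rewrite eqxx oner_eq0.
  by rewrite lift_eqF scale0r.
by move/le_trans/(_ Nv)/le_lt_trans/(_ hD); rewrite ltxx.
Qed.

Lemma gross2_succ_min x1 x2 x3 (n : nat) D : unital_basis O x1 x2 x3 ->
  G x1 x1 = 3 -> G x2 x2 = 3 -> G x3 x3 = 3 -> (n < 3)%N ->
  is_succ_min a b L n.+1 D <-> D = 3.
Proof.
move=> bas G1 G2 G3 n3; split=> [[h hmin]|->].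
  apply/le_anti/andP; split; rewrite leNgt; apply/negP => lt.
    by apply: (hmin _ lt); apply: gross2_span_rank bas G1 G2 G3 n3 _.
  exact: gross2_span_rank_lt lt h.
split; first exact: gross2_span_rank bas G1 G2 G3 n3 _.
by move=> D'; apply: gross2_span_rank_lt.
Qed.

Lemma gross2_well_rounded : well_rounded3 a b L.
Proof.
have [x1 [x2 [x3 [bas G1 G2 G3]]]] := gross2_basis.
have [v [hv free]] := gross2_span_rank bas G1 G2 G3 (leqnn 3) (lexx 3).
exists v; split; first by move=> i; case: (hv i).
by split=> // i x Lx nx; apply: le_trans (proj2 (hv i)) (gross2_min Lx nx).
Qed.

Lemma gross2_normalized_smb : exists beta, normalized_smb a b L beta.
Proof.
have [x1 [x2 [x3 [bas G1 G2 G3]]]] := gross2_basis.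
have GN x y : G x (- y) = - G x y by rewrite -scaleN1r gramGZr mulN1r.
have GNN x : G (- x) (- x) = G x x by rewrite GN gramGC GN opprK.
(* Negating [x2] or [x3] keeps the norms and makes the products with [x1] nonnegative. *)
have [y2 [bas2 G2' p2]] : exists y2, [/\ unital_basis O x1 y2 x3, G y2 y2 = 3 & 0 <= G x1 y2].
  case: (lerP 0 (G x1 x2)) => h; first by exists x2.
  exists (- x2); rewrite GNN GN oppr_ge0 ltW //; split=> //.
  exact: (unital_opp2 ord).
have [y3 [bas3 G3' p3]] : exists y3, [/\ unital_basis O x1 y2 y3, G y3 y3 = 3 & 0 <= G x1 y3].
  case: (lerP 0 (G x1 x3)) => h; first by exists x3.
  exists (- x3); rewrite GNN GN oppr_ge0 ltW //; split=> //.
  exact: (unital_opp3 ord).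
exists (vec3 (pure x1) (pure y2) (pure y3)); split; last by rewrite -!gramG_qinner.
split; first exact: (Zbasis_of_unital ord bas3).
move=> i; apply/(gross2_succ_min _ bas3 G1 G2' G3' (ltn_ord i)).
by case: i => [[|[|[|i]]] hi] //=; apply: gross2_norm.
Qed.

(** The minors [9 - s^2] are positive multiples of 8, so [s = 1] for the two nonnegative entries;
    the determinant 16 then gives [(t + 1) (3 t - 5) = 0] for the last one. *)
Lemma gross2_gram beta : normalized_smb a b L beta -> gram a b beta = gram_p2.
Proof.
move=> [[zb sm] [p12 p13]].
have [w1 [w2 [w3 [bas0 E1 E2 E3]]]] := gross2_basis.
have [x1 [x2 [x3 [bas eb]]]] := unital_of_Zbasis ord zb.
have [h1 h2 h3] : [/\ O x1, O x2 & O x3] by case: bas => _ [].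
have norm i : qinner a b (beta i) (beta i) = 3.
  rewrite qinner_nrd; apply/(gross2_succ_min _ bas0 E1 E2 E3 (ltn_ord i)); exact: sm.
have G1 : G x1 x1 = 3 by rewrite gramG_qinner -[RHS](norm 0) eb.
have G2 : G x2 x2 = 3 by rewrite gramG_qinner -[RHS](norm 1) eb.
have G3 : G x3 x3 = 3 by rewrite gramG_qinner -[RHS](norm 2%:R) eb.
rewrite !eb -!gramG_qinner in p12 p13.
have key (s m : int) : 0 <= s -> 0 < 4 * 2 * m -> 3 * 3 - s * s = 4 * 2 * m -> s = 1.
  move=> s0 m0 e; have s3 : s < 3 by nia.
  have : s = 0 \/ s = 1 \/ s = 2 by lia.
  by case=> [es|[//|es]]; move: e; rewrite es; lia.
have one x y : O x -> O y -> G x x = 3 -> G y y = 3 -> 0 < M x y y -> 0 <= G x y -> G x y = 1.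
  move=> hx hy gx gy; have [m [_ [em _]]] := gramG_minor_dvd hp hB maxO bas hx hy hy.
  rewrite em; move: em; rewrite proj_gramE gx gy; have /intrP[s ->] := gramG_int ord hx hy.
  rewrite -[3]/(3%:~R) -!rmorphM -rmorphB => /intr_inj e; rewrite ltr0z ler0z => m0 s0.
  rewrite -[1]/(1%:~R); congr _%:~R.
  exact: key s0 m0 e.
have G12 := one _ _ h1 h2 G1 G2 (proj_gram_gt0 ord pos bas) p12.
have G13 := one _ _ h1 h3 G1 G3 (proj_gram_gt0 ord pos (unital_swap23 bas)) p13.
have G23 : G x2 x3 = -1.
  have := gramG_det_Bp hp hB maxO bas; rewrite G1 G2 G3 G12 G13.
  have /intrP[t ->] := gramG_int ord h2 h3; move=> e.
  have {}e : 27 + 2 * t - 3 * t ^+ 2 - 3 - 3 = 16.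
    rewrite -[16]/(4 * 2%:Z ^+ 2); apply: (@intr_inj rat); rewrite -e.
    by rewrite !(rmorphM, rmorphB, rmorphD, rmorphXn) /=; ring.
  rewrite -[-1]/((-1)%:~R); congr _%:~R.
  have : (t + 1) * (3 * t - 5) = 0 by rewrite (_ : _ * _ = 3 * t ^+ 2 - 2 * t - 5); [lia | ring].
  by move/eqP; rewrite mulf_eq0 => /orP[] /eqP; clear; lia.
apply/matrixP => i j; rewrite !mxE !eb.
have G21 : G x2 x1 = 1 by rewrite gramGC.
have G31 : G x3 x1 = 1 by rewrite gramGC.
have G32 : G x3 x2 = -1 by rewrite gramGC.
case: i => [[|[|[|i]]] hi]; last (by []); (case: j => [[|[|[|j]]] hj]; last by []);
  rewrite /vec3 /= -gramG_qinner.
all: by rewrite ?(G1, G12, G13, G21, G2, G23, G31, G32, G3).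
Qed.

End Two.

Theorem mainTheorem13 (p : nat) (hp : prime p) :
  (p = 2%N ->
    forall (a b : int) (O : quat -> Prop), is_Bp p a b -> maximal_order a b O ->
      well_rounded3 a b (gross_lattice O) /\
      ~ orthogonal_lattice a b (gross_lattice O) /\
      (exists beta, normalized_smb a b (gross_lattice O) beta) /\
      (forall beta, normalized_smb a b (gross_lattice O) beta ->
                    gram a b beta = gram_p2)) /\
  ((3 <= p)%N ->
    forall (a b : int) (O : quat -> Prop), is_Bp p a b -> maximal_order a b O ->
      ~ orthogonal_lattice a b (gross_lattice O) /\
      ~ well_rounded3 a b (gross_lattice O)).
Proof.
split=> [p2|p3] a b O hB maxO.
  have orth := gross_not_orthogonal hp hB maxO; rewrite p2 in hB.
  split; first exact: gross2_well_rounded hB maxO.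
  split=> //; split; first exact: gross2_normalized_smb hB maxO.
  exact: gross2_gram hB maxO.
by split; [exact: (gross_not_orthogonal hp hB maxO) | exact: (gross_not_well_rounded hp p3 hB maxO)].
Qed.
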